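(* Let $G$ be a compact connected Lie group with Lie algebra $\mathfrak g$, and let $\eta\in\mathfrak g^*$. Let $(G\times\mathfrak g\times\mathfrak g^*\times\mathfrak g^* )_\eta=J^{-1}(\eta)/G_\eta$ be the point reduced space at $\eta$ of the $G$-action $\phi(g,(x,Y,\mu,\xi))=(gx,Y,\mu,\xi)$ with momentum map $J(x,Y,\mu,\xi)=\mathrm{Ad}^*_{x^{-1}}(\mu-\mathrm{ad}^*_Y\xi)$. Then $(G\times\mathfrak g\times\mathfrak g^*\times\mathfrak g^* )_\eta$ is diffeomorphic to $\mathcal O_\eta\times\mathfrak g\times\mathfrak g^*$, where $\mathcal O_\eta$ is the coadjoint orbit of $\eta$.
   Context: Conventions: for $\xi\in\mathfrak g^*$, $x\in G$, $Y\in\mathfrak g$: $\mathrm{Ad}^*_x\xi=\xi\circ\mathrm{Ad}_x$ and $\mathrm{ad}^*_Y\xi=\xi\circ\mathrm{ad}_Y$, with $\mathrm{ad}_YZ=[Y,Z]$. The isotropy subgroup is $G_\eta=\{g\in G:\mathrm{Ad}^*_{g^{-1}}\eta=\eta\}$ and $\mathcal O_\eta=\{\mathrm{Ad}^*_x\eta:x\in G\}$. One has $J^{-1}(\eta)=\{(x,Y,\mu,\xi)\in G\times\mathfrak g\times\mathfrak g^*\times\mathfrak g^*:\mu=\mathrm{Ad}^*_x\eta+\mathrm{ad}^*_Y\xi\}$, a submanifold invariant under $G_\eta$; $G_\eta$ acts on it by restriction of $\phi$, freely and properly, so the quotient is a smooth manifold (with the projection a submersion). *)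

(* Defs.v *)
From HB Require Import structures.
From mathcomp Require Import all_boot all_order all_algebra.
From mathcomp Require Import all_classical all_reals all_analysis.

Set Implicit Arguments.
Unset Strict Implicit.
Unset Printing Implicit Defensive.

Import Order.TTheory GRing.Theory Num.Theory.
Import numFieldNormedType.Exports.

Local Open Scope classical_set_scope.
Local Open Scope ring_scope.

(** * Smooth maps between open subsets of finite-dimensional normed spaces *)

Section SmoothOn.
Context {R : realType} {V W : normedModType R}.

Fixpoint iter_derive (s : seq V) (f : V -> W) : V -> W :=
  if s is v :: s' then fun x => 'D_v (iter_derive s' f) x else f.

(** [f] is of class C^oo on the open set [U]: all iterated directional
    derivatives exist and are continuous at the points of [U].  This is the
    usual notion because [V] is only ever instantiated with a product of spaces
    of row and column vectors.  Only the germs of [f] at the points of [U]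
    matter. *)
Definition smooth_on (U : set V) (f : V -> W) : Prop :=
  forall (s : seq V) (x : V), U x ->
    {for x, continuous (iter_derive s f)} /\
    forall v : V, derivable (iter_derive s f) x v.

End SmoothOn.

(** * Smooth manifolds *)

(** The values of [fwd] outside [dom] and of [bwd] outside [fwd @` dom] are
    irrelevant. *)
Record chart {R : realType} (V : normedModType R) (M : Type) := Chart {
  dom : set M ;
  fwd : M -> V ;
  bwd : V -> M
}.

Section Manifold.
Context {R : realType} {V : normedModType R} {M : topologicalType}.

Definition img (c : chart V M) : set V := fwd c @` dom c.

Definition is_chart (c : chart V M) : Prop :=
  [/\ open (dom c), open (img c),
      {in dom c, cancel (fwd c) (bwd c)},
      {within dom c, continuous (fwd c)} &
      {within img c, continuous (bwd c)}].

Definition smooth_manifold (A : set (chart V M)) : Prop :=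
  [/\ hausdorff_space M, @second_countable M,
      forall c, A c -> is_chart c,
      forall p, exists2 c, A c & dom c p &
      forall c c', A c -> A c' ->
        smooth_on (fwd c @` (dom c `&` dom c')) (fwd c' \o bwd c)].

End Manifold.

Definition vect_atlas {R : realType} (V : normedModType R) : set (chart V V) :=
  [set Chart setT id id].
Arguments vect_atlas {R} V _.

Definition prod_chart {R : realType} {V W : normedModType R} {M N : Type}
    (c : chart V M) (d : chart W N) : chart (V * W)%type (M * N)%type :=
  Chart (dom c `*` dom d) (fun p => (fwd c p.1, fwd d p.2))
        (fun w => (bwd c w.1, bwd d w.2)).

Definition prod_atlas {R : realType} {V W : normedModType R} {M N : Type}
    (A : set (chart V M)) (B : set (chart W N)) :
    set (chart (V * W)%type (M * N)%type) :=
  [set e | exists c d, [/\ A c, B d & e = prod_chart c d]].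

Section SmoothMaps.
Context {R : realType} {V W : normedModType R} {M N : topologicalType}.
Variables (A : set (chart V M)) (B : set (chart W N)).

Definition local_repr (c : chart V M) (d : chart W N) (f : M -> N) : V -> W :=
  fwd d \o f \o bwd c.

Definition smooth (f : M -> N) : Prop :=
  continuous f /\
  forall c d, A c -> B d ->
    smooth_on (fwd c @` (dom c `&` f @^-1` dom d)) (local_repr c d f).

Definition immersion (f : M -> N) : Prop :=
  smooth f /\
  forall c d p, A c -> B d -> dom c p -> dom d (f p) ->
    injective ('d (local_repr c d f) (fwd c p)).

Definition submersion (f : M -> N) : Prop :=
  smooth f /\
  forall c d p, A c -> B d -> dom c p -> dom d (f p) ->
    forall w, exists v, 'd (local_repr c d f) (fwd c p) v = w.

End SmoothMaps.

Definition diffeomorphic {R : realType} {V W : normedModType R}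
    {M N : topologicalType} (A : set (chart V M)) (B : set (chart W N)) : Prop :=
  exists (f : M -> N) (g : N -> M),
    [/\ smooth A B f, smooth B A g, cancel f g & cancel g f].

(** [S], seen as a type, carries the subspace topology, so that the inclusion of
    [S] is a homeomorphism onto its image: these are the embedded submanifolds. *)
Definition submanifold {R : realType} {V W : normedModType R}
    {M : topologicalType} (A : set (chart V M)) (S : set M)
    (B : set (chart W S)) : Prop :=
  smooth_manifold B /\ immersion B A (set_val : S -> M).

(** * Orbit spaces *)

(** [orb p] is meant to be the orbit of [p]; a point of the orbit space is an
    orbit, and the topology is the quotient topology. *)
Section OrbitSpace.
Context {T : topologicalType} (orb : T -> set T).

Definition orbit_space : Type := {O : set T | exists p, O = orb p}.

Definition orbit_proj (p : T) : orbit_space :=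
  exist _ (orb p) (ex_intro _ p erefl).

HB.instance Definition _ := gen_eqMixin orbit_space.
HB.instance Definition _ := gen_choiceMixin orbit_space.

Definition orbit_space_open (U : set orbit_space) := open (orbit_proj @^-1` U).

Let orbit_openT : orbit_space_open setT.
Proof. by rewrite /orbit_space_open preimage_setT; exact: openT. Qed.

Let orbit_openI : setI_closed orbit_space_open.
Proof. by move=> U U'; exact: openI. Qed.

Let orbit_open_bigU (I : Type) (F : I -> set orbit_space) :
  (forall i, orbit_space_open (F i)) -> orbit_space_open (\bigcup_i F i).
Proof. by move=> oF; apply: bigcup_open => i _; exact: oF. Qed.

HB.instance Definition _ :=
  isOpenTopological.Build orbit_space orbit_openT orbit_openI orbit_open_bigU.

End OrbitSpace.

(** * Lie groups *)

#[short(type="groupTopologicalType")]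
HB.structure Definition GroupTopological := {G of Topological G & Group G}.

Definition lie_group {R : realType} {n : nat} {G : groupTopologicalType}
    (A : set (chart 'rV[R]_n G)) : Prop :=
  [/\ smooth_manifold A,
      smooth (prod_atlas A A) A (fun p : G * G => (p.1 * p.2)%g) &
      smooth A A (fun x : G => (x^-1)%g)].

(** Below, [c] is a chart of [G] around the unit.  The Lie algebra g = T_1 G is
    identified with ['rV_n] through the differential of [c] at the unit, and its
    dual g^* with ['cV_n], the covector [xi] being the form
    [Y |-> Y *m xi : 'M_1]. *)
Section Coadjoint.
Context {R : realType} {n : nat} {G : groupTopologicalType}.
Variable c : chart 'rV[R]_n G.
Implicit Types (x g : G) (Y Z : 'rV[R]_n) (mu xi eta : 'cV[R]_n).

Definition covector_comp xi (f : 'rV[R]_n -> 'rV[R]_n) : 'cV[R]_n :=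
  lin1_mx f *m xi.

Lemma covector_compE xi (f : {linear 'rV[R]_n -> 'rV[R]_n}) Y :
  Y *m covector_comp xi f = f Y *m xi.
Proof. by rewrite /covector_comp mulmxA mul_rV_lin1. Qed.

Definition Ad x Y : 'rV[R]_n :=
  'd (fun u => fwd c (x * bwd c u * x^-1)%g) (fwd c 1%g) Y.

(** The expression in the chart [c] of the left invariant vector field whose
    value at the unit is [Y]. *)
Definition left_invariant Y (u : 'rV[R]_n) : 'rV[R]_n :=
  'd (fun v => fwd c (bwd c u * bwd c v)%g) (fwd c 1%g) Y.

Definition vector_field_bracket (X X' : 'rV[R]_n -> 'rV[R]_n) (u : 'rV[R]_n) :=
  'd X' u (X u) - 'd X u (X' u).

Definition lie_bracket Y Z : 'rV[R]_n :=
  vector_field_bracket (left_invariant Y) (left_invariant Z) (fwd c 1%g).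

Definition ad Y Z : 'rV[R]_n := lie_bracket Y Z.

Definition Ad_star x xi : 'cV[R]_n := covector_comp xi (Ad x).
Definition ad_star Y xi : 'cV[R]_n := covector_comp xi (ad Y).

Definition isotropy eta : set G := [set g | Ad_star g^-1%g eta = eta].
Definition coadjoint_orbit eta : set 'cV[R]_n := [set Ad_star x eta | x in setT].

Definition phase_space : Type := (G * 'rV[R]_n * 'cV[R]_n * 'cV[R]_n)%type.

Definition action g (p : phase_space) : phase_space :=
  let: (x, Y, mu, xi) := p in ((g * x)%g, Y, mu, xi).

Definition momentum_map (p : phase_space) : 'cV[R]_n :=
  let: (x, Y, mu, xi) := p in Ad_star x^-1%g (mu - ad_star Y xi).

Definition momentum_level eta : set phase_space :=
  [set p | momentum_map p = eta].

Definition isotropy_orbit eta (p : momentum_level eta) :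
    set (momentum_level eta) :=
  [set q | exists2 g, isotropy eta g & set_val q = action g (set_val p)].

Definition reduced_space eta := orbit_space (@isotropy_orbit eta).

Definition reduction eta : momentum_level eta -> reduced_space eta :=
  orbit_proj (@isotropy_orbit eta).

End Coadjoint.

Arguments phase_space R n G : clear implicits.
Arguments reduction {R n G} c eta p.

Definition phase_atlas {R : realType} {n : nat} {G : groupTopologicalType}
    (A : set (chart 'rV[R]_n G)) :
    set (chart ('rV[R]_n * 'rV[R]_n * 'cV[R]_n * 'cV[R]_n)%type
               (phase_space R n G)) :=
  prod_atlas (prod_atlas (prod_atlas A (vect_atlas 'rV[R]_n))
                         (vect_atlas 'cV[R]_n)) (vect_atlas 'cV[R]_n).

(* Main.v *)
Require Import Defs.
From HB Require Import structures.
From mathcomp Require Import all_boot all_order all_algebra.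
From mathcomp Require Import all_classical all_reals all_analysis.
From mathcomp Require Import ring lra.

Set Implicit Arguments.
Unset Strict Implicit.
Unset Printing Implicit Defensive.

Import Order.TTheory GRing.Theory Num.Theory.
Import numFieldNormedType.Exports.

Local Open Scope classical_set_scope.
Local Open Scope ring_scope.

(** The fibres of [p = (x, Y, mu, xi) |-> (Ad*_x eta, Y, xi)] on the level set
    are exactly the orbits of the isotropy group, whence a bijection of the
    reduced space onto [O_eta * g * g^*].  It is smooth since [reduction] has
    smooth local sections.  Its inverse sends [(Ad*_x eta, Y, xi)] to the class of
    [(x, Y, Ad*_x eta + ad*_Y xi, xi)], hence is smooth as soon as the orbit map
    [x |-> Ad*_x eta] from [G] to [O_eta] has smooth local sections, i.e. is a
    submersion.  By equivariance the orbit map has constant rank [r].  If [r] were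
    smaller than the dimension of [O_eta], the constant rank theorem would make
    the image of each small piece of [G] nowhere dense, and by compactness of [G]
    the whole of [O_eta] would be nowhere dense in itself. *)

(** * Maps of class C^k at a point *)

(** The manifold structures on the level set, the orbit and the quotient are arbitrary ones with the
    stated properties, and their dimensions [k], [l], [m] are not related in advance. Hence [m]
    cannot be read off from the isotropy group: the possibility that [G] covers the orbit with rank
    below [m] has to be excluded, and compactness does here what the theorems of Baire or Sard do in
    general. Maps into the level set or the orbit are treated without adapted charts. The
    differential of an immersion has a linear left inverse, so the derivatives of a continuous map
    can be solved for from those of its composite with the immersion. Smoothness is given by
    iterated directional derivatives on open sets, whereas the chain rule and the inverse function
    theorem need total differentials; passing from one to the other requires finite dimension and
    continuity of the partial derivatives. *)

Lemma near_eq_cont (S T : topologicalType) (f g : S -> T) (x : S) :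
  (\forall y \near x, f y = g y) -> {for x, continuous f} ->
  {for x, continuous g}.
Proof.
move=> fg cf; rewrite /prop_for /continuous_at -(nbhs_singleton fg).
apply: cvg_trans cf; apply: near_eq_cvg; exact: filterS fg.
Qed.

Section Differentials.
Context {R : realType}.
Implicit Types U V W : normedModType R.

(** A spanning family with continuous coordinate forms; independence is not asked for. In this form
    the property passes to products at once, and continuity of linear maps needs no comparison of
    norms. *)
Definition findim V : Prop :=
  exists (I : finType) (b : I -> V) (c : I -> {linear V -> R}),
    (forall i, continuous (c i)) /\ forall v, v = \sum_i c i v *: b i.

Lemma diff_eps V W (f : V -> W) (x : V) (df : {linear V -> W}) :
  continuous df ->
  (forall e, 0 < e -> \forall h \near 0, `|f (h + x) - f x - df h| <= e * `|h|) ->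
  is_diff x f df.
Proof.
move=> cdf fdf.
have H : f \o shift x = cst (f x) + df +o_ 0 id.
  apply/eqaddoP => e e0; near=> h.
  rewrite /= -[leLHS]/(`|f (h + x) - (f x + df h)|) opprD addrA.
  by near: h; exact: fdf.
have E := diff_unique cdf H.
by split=> //; apply/diff_locallyP; rewrite E.
Unshelve. all: by end_near. Qed.

Lemma diff_epsE V W (f : V -> W) (x : V) e : differentiable f x -> 0 < e ->
  \forall h \near 0, `|f (h + x) - f x - 'd f x h| <= e * `|h|.
Proof.
move=> /diff_locallyP[_ /eqaddoP] /(_ _) H e0.
near=> h; rewrite -addrA -opprD.
by near: h; exact: H.
Unshelve. all: by end_near. Qed.

Lemma near0_shift V (x : V) (P : V -> Prop) :
  (\forall y \near x, P y) -> \forall h \near 0, P (h + x).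
Proof.
move=> Px; have : (h : V) + x @[h --> 0] --> x.
  by rewrite -[X in _ --> X]add0r; apply: cvgD; [exact: cvg_id|exact: cvg_cst].
exact.
Qed.

Lemma near_eq_diff V W (f g : V -> W) (x : V) :
  (\forall y \near x, f y = g y) -> differentiable f x ->
  is_diff x g ('d f x).
Proof.
move=> fg df; apply: diff_eps => [|e e0]; first exact: diff_continuous.
have fgx := nbhs_singleton fg.
near=> h; rewrite -fgx.
have <- : f (h + x) = g (h + x).
  by near: h; exact: near0_shift fg.
by near: h; exact: diff_epsE.
Unshelve. all: by end_near. Qed.

Lemma linear_fun_ex V W (f : V -> W) : linear f ->
  exists L : {linear V -> W}, L = f :> (V -> W).
Proof.
move=> flin; pose fL := GRing.isLinear.Build _ _ _ _ f flin.
pose g : {linear V -> W} := HB.pack f fL.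
by exists g.
Qed.

Lemma findim_mx m n : findim 'M[R]_(m, n).
Proof.
exists ('I_m * 'I_n)%type, (fun i => delta_mx i.1 i.2).
have /choice[c cE] : forall i : 'I_m * 'I_n, exists L : {linear 'M[R]_(m, n) -> R},
    L = (fun A => A i.1 i.2) :> (_ -> R).
  by move=> i; apply: linear_fun_ex => a A B; rewrite !mxE.
exists c; split=> [i|A]; first by rewrite cE; exact: coord_continuous.
by under eq_bigr do rewrite cE; rewrite {1}[A]matrix_sum_delta pair_bigA.
Qed.

Lemma findim_prod V W : findim V -> findim W -> findim (V * W)%type.
Proof.
move=> [I [b [c [cc bc]]]] [J [d [e [ce de]]]].
exists (I + J)%type.
exists (fun k => match k with inl i => (b i, 0) | inr j => (0, d j) end).
exists (fun k => match k return {linear (V * W)%type -> R} with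
  inl i => c i \o fst | inr j => e j \o snd end).
split=> [[i|j] x|[v w]] /=.
- by apply: continuous_comp; [exact: cvg_fst|exact: cc].
- by apply: continuous_comp; [exact: cvg_snd|exact: ce].
have sumE (K : finType) (F : K -> (V * W)%type) :
    \sum_k F k = (\sum_k (F k).1, \sum_k (F k).2).
  by elim/big_ind3 : _ => // [x1 x2 x3 y1 y2 y3 -> ->|k _] //; case: (F k).
rewrite sumE !big_sumType /=; congr pair.
  by rewrite [X in _ + X]big1 ?addr0 // => j _; rewrite scaler0.
by rewrite [X in X + _]big1 ?add0r // => i _; rewrite scaler0.
Qed.

Lemma findim_linear_continuous V W (f : {linear V -> W}) :
  findim V -> continuous f.
Proof.
move=> [I [b [c [cc bc]]]] x.
rewrite (_ : (f : V -> W) = \sum_i (fun v => c i v *: f (b i))).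
  elim/big_ind : _ => [|g h cg ch|i _]; first exact: cvg_cst.
    exact: (continuousD cg ch).
  exact: (continuousZr_tmp (cc i x)).
apply/funext => v; rewrite fct_sumE {1}[v]bc linear_sum.
by apply: eq_bigr => i _; rewrite linearZ.
Qed.

(* Unlike [smooth_on], a notion about the germ of [f] at [x]: compositions need no
   bookkeeping of domains. *)
Fixpoint Ck (k : nat) V W (f : V -> W) (x : V) : Prop :=
  if k is k'.+1 then
    (\forall y \near x, differentiable f y) /\ forall v, Ck k' ('D_v f) x
  else \forall y \near x, {for y, continuous f}.

Definition smooth_at V W (f : V -> W) (x : V) := forall k, Ck k f x.

Lemma smooth_atP V W (f : V -> W) (x : V) : smooth_at f x <->
  (\forall y \near x, differentiable f y) /\ forall v, smooth_at ('D_v f) x.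
Proof.
split=> [sf|[df sf] k].
  by split=> [|v k]; [exact: (sf 1%N).1 | exact: (sf k.+1).2].
case: k => [|k]; last by split=> // v; exact: sf.
by near=> y; apply: differentiable_continuous; near: y.
Unshelve. all: by end_near. Qed.

Lemma smooth_at_near_diff V W (f : V -> W) (x : V) : smooth_at f x ->
  \forall y \near x, differentiable f y.
Proof. by move=> /(_ 1%N)[]. Qed.

Lemma smooth_at_diff V W (f : V -> W) (x : V) : smooth_at f x ->
  differentiable f x.
Proof. by move=> /smooth_at_near_diff/nbhs_singleton. Qed.

Lemma smooth_at_cont V W (f : V -> W) (x : V) : smooth_at f x ->
  {for x, continuous f}.
Proof. by move=> /smooth_at_diff/differentiable_continuous. Qed.

Lemma near_eq_Ck k V W (f g : V -> W) (x : V) :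
  (\forall y \near x, f y = g y) -> Ck k f x -> Ck k g x.
Proof.
elim: k f g => [|k IH] f g fg /= => [cf|[df kf]].
  near=> y; apply: (@near_eq_cont _ _ f) => //; near: y => //.
  exact: near_join.
have nfg := near_join fg.
split.
  near=> y; have H : is_diff y g ('d f y) by apply: near_eq_diff; near: y.
  exact: ex_diff.
move=> v; apply: (IH ('D_v f)) (kf v).
near=> y; apply: near_eq_derive; near: y; exact: nfg.
Unshelve. all: by end_near. Qed.

Lemma near_eq_smooth V W (f g : V -> W) (x : V) :
  (\forall y \near x, f y = g y) -> smooth_at f x -> smooth_at g x.
Proof. by move=> fg sf k; exact: near_eq_Ck (sf k). Qed.

Lemma Ck_pred k V W (f : V -> W) (x : V) : Ck k.+1 f x -> Ck k f x.
Proof.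
elim: k f => [|k IH] f [df kf]; last by split=> // v; apply: IH; exact: kf.
by near=> y; apply: differentiable_continuous; near: y.
Unshelve. all: by end_near. Qed.

Lemma Ck_cst k V W (a : W) (x : V) : Ck k (cst a) x.
Proof.
elim: k a => [|k IH] a /=; first by near=> y; exact: cvg_cst.
split=> [|v]; first by near=> y; exact: differentiable_cst.
by rewrite (_ : derive _ ^~ _ = cst 0)//; apply/funext => y; rewrite derive_cst.
Unshelve. all: by end_near. Qed.

Lemma Ck_linear k V W (f : {linear V -> W}) (x : V) : continuous f -> Ck k f x.
Proof.
case: k => [|k] cf; first by near=> y; exact: cf.
split=> [|v]; first by near=> y; exact: linear_differentiable.
rewrite (_ : derive _ ^~ _ = cst (f v)); first exact: Ck_cst.
by apply/funext => y; rewrite deriveE ?diff_lin//; exact: linear_differentiable.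
Unshelve. all: by end_near. Qed.

Lemma Ck_id k V (x : V) : Ck k id x.
Proof. by apply: (@Ck_linear k V V idfun) => y; exact: cvg_id. Qed.

Lemma CkD k V W (f g : V -> W) (x : V) : Ck k f x -> Ck k g x ->
  Ck k (fun y => f y + g y) x.
Proof.
elim: k f g => [|k IH] f g => [cf cg|[df kf] [dg kg]].
  by near=> y; apply: continuousD; near: y.
split=> [|v]; first by near=> y; apply: differentiableD; near: y.
apply: near_eq_Ck (IH _ _ (kf v) (kg v)).
by near=> y; rewrite deriveD//; apply: diff_derivable; near: y.
Unshelve. all: by end_near. Qed.

Lemma Ck_sum k V W (I : Type) (r : seq I) (P : pred I) (f : I -> V -> W) x :
  (forall i, P i -> Ck k (f i) x) -> Ck k (fun y => \sum_(i <- r | P i) f i y) x.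
Proof.
move=> kf; rewrite (_ : (fun y => _) = \sum_(i <- r | P i) f i); last first.
  by apply/funext => y; rewrite fct_sumE.
elim/big_ind : _ => [|g h kg kh|//]; [exact: Ck_cst | exact: CkD].
Qed.

Lemma Ck_comp_linear k U V W (L : {linear V -> W}) (f : U -> V) x :
  continuous L -> Ck k f x -> Ck k (fun y => L (f y)) x.
Proof.
move=> cL; elim: k f => [|k IH] f => [cf|[df kf]].
  by near=> y; apply: continuous_comp; [near: y|exact: cL].
split=> [|v].
  near=> y; apply: (@differentiable_comp _ _ _ _ f L); first by near: y.
  exact: linear_differentiable.
apply: near_eq_Ck (IH _ (kf v)).
have dL z : differentiable L z by exact: linear_differentiable.
near=> y; rewrite [RHS]deriveE; last first.
  by apply: (@differentiable_comp _ _ _ _ f L) => //; near: y.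
rewrite (@diff_comp _ _ _ _ f L) //=; last by near: y.
by rewrite diff_lin// -deriveE//; near: y.
Unshelve. all: by end_near. Qed.

Lemma Ck_pair k U V W (f : U -> V) (g : U -> W) x :
  Ck k f x -> Ck k g x -> Ck k (fun y => (f y, g y)) x.
Proof.
elim: k f g => [|k IH] f g => [cf cg|[df kf] [dg kg]].
  by near=> y; apply: cvg_pair; near: y.
split=> [|v]; first by near=> y; apply: differentiable_pair; near: y.
apply: near_eq_Ck (IH _ _ (kf v) (kg v)).
near=> y; rewrite !deriveE ?diff_pair//; try by near: y.
by apply: differentiable_pair; near: y.
Unshelve. all: by end_near. Qed.

Lemma CkM k V (f g : V -> R) (x : V) : Ck k f x -> Ck k g x ->
  Ck k (fun y => f y * g y) x.
Proof.
elim: k f g => [|k IH] f g => [cf cg|fk gk].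
  by near=> y; apply: continuousM; near: y.
have [df kf] := fk; have [dg kg] := gk.
split=> [|v]; first by near=> y; apply: differentiableM; near: y.
apply: near_eq_Ck (CkD (IH _ _ (Ck_pred fk) (kg v)) (IH _ _ (Ck_pred gk) (kf v))).
by near=> y; rewrite deriveM//; apply: diff_derivable; near: y.
Unshelve. all: by end_near. Qed.

Lemma Ck_scalel k V W (f : V -> R) (w : W) (x : V) : Ck k f x ->
  Ck k (fun y => f y *: w) x.
Proof.
have lin : linear (fun a : R => a *: w) by move=> a u v; rewrite scalerDl scalerA.
have [L LE] := linear_fun_ex lin.
move=> kf; have := @Ck_comp_linear k V R W L f x; rewrite LE; apply => //.
exact: scalel_continuous.
Qed.

Lemma CkZ k V W (f : V -> R) (g : V -> W) (x : V) : findim W ->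
  Ck k f x -> Ck k g x -> Ck k (fun y => f y *: g y) x.
Proof.
move=> [I [b [c [cc bc]]]] kf kg.
rewrite (_ : (fun y => _) = (fun y => \sum_i (f y * c i (g y)) *: b i)).
  by apply: Ck_sum => i _; apply: Ck_scalel; apply: CkM => //; exact: Ck_comp_linear.
apply/funext => y; rewrite {1}[g y]bc scaler_sumr.
by apply: eq_bigr => i _; rewrite scalerA.
Qed.

Lemma Ck_comp k U V W (f : U -> V) (g : V -> W) (x : U) :
  findim V -> findim W -> Ck k f x -> Ck k g (f x) -> Ck k (fun y => g (f y)) x.
Proof.
move=> [I [b [c [cc bc]]]] fW; elim: k f g => [|k IH] f g.
  move=> cf cg; have cgf : \forall y \near x, {for f y, continuous g}.
    have cfx : {for x, continuous f} := nbhs_singleton cf.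
    exact: (cfx _ cg).
  near=> y; have cfy : {for y, continuous f} by near: y.
  have cgy : {for f y, continuous g} by near: y.
  exact: continuous_comp.
move=> fk gk; have [df kf] := fk; have [dg kg] := gk.
have cf : {for x, continuous f} := differentiable_continuous (nbhs_singleton df).
have dgf : \forall y \near x, differentiable g (f y).
  exact: (cf _ dg).
split=> [|v].
  by near=> y; apply: (@differentiable_comp _ _ _ _ f g); near: y.
(* The chain rule differentiates [g] in a direction that varies with [y]; the family [b] replaces it
   by finitely many fixed directions, to which the induction hypothesis applies. *)
pose h y := \sum_i c i ('D_v f y) *: 'D_(b i) g (f y).
apply: (@near_eq_Ck k _ _ h).
  near=> y; have dfy : differentiable f y by near: y.
  have dgy : differentiable g (f y) by near: y.
  rewrite /h [RHS]deriveE; last exact: (@differentiable_comp _ _ _ _ f g).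
  rewrite (@diff_comp _ _ _ _ f g)//= -(deriveE v dfy).
 rewrite [derive f y v in RHS]bc linear_sum; apply: eq_bigr => i _.
  by rewrite (deriveE _ dgy) linearZ.
apply: Ck_sum => i _; apply: CkZ => //.
  exact: (Ck_comp_linear (cc i) (kf v)).
by apply: (IH f ('D_(b i) g)); [exact: Ck_pred|exact: kg].
Unshelve. all: by end_near. Qed.

Lemma CkV k V (f : V -> R) (x : V) : f x != 0 -> Ck k f x ->
  Ck k (fun y => (f y)^-1) x.
Proof.
move=> fx0; elim: k => [|k IH] fk.
  have nf : \forall y \near x, f y != 0.
    have cfx : {for x, continuous f} := nbhs_singleton fk.
    exact: cvgr_neq0 cfx fx0.
  near=> y; have fy0 : f y != 0 by near: y.
  have cfy : {for y, continuous f} by near: y.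
  exact: cvgV cfy.
have [df kf] := fk.
have cf : {for x, continuous f} := differentiable_continuous (nbhs_singleton df).
have nf : \forall y \near x, f y != 0.
  exact: cvgr_neq0 cf fx0.
split=> [|v].
  by near=> y; apply: differentiableV; near: y.
(* The derivative of [f^-1] is [- f^-2 * 'D_v f], in which [f^-1] is of class C^k by induction. *)
have H := IH (Ck_pred fk).
have H2 := Ck_scalel (-1 : R) (CkM (CkM H H) (kf v)).
apply: near_eq_Ck H2; near=> y.
rewrite deriveV//; last 2 first.
- by near: y.
- by apply: diff_derivable; near: y.
by rewrite -exprVn expr2 -![_ *: _]/(_ * _) mulrN1 mulNr.
Unshelve. all: by end_near. Qed.

End Differentials.

(** * Continuous partial derivatives and total differentiability *)

Section ContinuousPartials.
Context {R : realType}.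
Implicit Types U V W : normedModType R.

(** The symmetric bound [|t| <= |a|] allows [a] of either sign, as needed for the coordinates of an
    increment. *)
Lemma MVT_dir V (f : V -> R) (y b : V) (a : R) :
  (forall t : R, `|t| <= `|a| -> derivable f (y + t *: b) b) ->
  exists2 t : R, `|t| <= `|a| & f (y + a *: b) - f y = a * 'D_b f (y + t *: b).
Proof.
move=> df; pose phi (t : R) : R := f (y + t *: b).
have dphi (t : R) : `|t| <= `|a| -> is_derive t 1 phi ('D_b f (y + t *: b)).
  move=> /df dft.
  have E : (fun h : R => h^-1 *: ((phi \o shift t) (h *: 1) - phi t)) =
           (fun h => h^-1 *: ((f \o shift (y + t *: b)) (h *: b) - f (y + t *: b))).
    apply/funext => h; rewrite /phi /=; congr (_ *: (f _ - _)).
    by rewrite [h *: 1]mulr1 scalerDl addrCA addrC.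
  by split; [rewrite /derivable E|rewrite /derive E].
have cphi (t : R) : `|t| <= `|a| -> {for t, continuous phi}.
  by move=> /dphi H; apply: differentiable_continuous; apply/derivable1_diffP.
have seg (u v : R) : u <= v -> `|u| <= `|a| -> `|v| <= `|a| ->
    exists2 t : R, `|t| <= `|a| & phi v - phi u = 'D_b f (y + t *: b) * (v - u).
  move=> uv ua va; have ina t : u <= t <= v -> `|t| <= `|a|.
    move: ua va; rewrite !ler_norml => /andP[ua _] /andP[_ va] /andP[ut tv].
    by rewrite (le_trans ua ut) (le_trans tv va).
  have [||t tuv E] := @MVT_segment R phi (fun t => 'D_b f (y + t *: b)) u v uv.
  - by move=> t; rewrite in_itv/= => /andP[? ?]; apply: dphi; apply: ina; rewrite !ltW.
  - apply: continuous_in_subspaceT => t; rewrite inE/= in_itv/= => tuv.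
    exact/cphi/ina.
  by exists t => //; apply: ina; move: tuv; rewrite in_itv.
have phi0 : phi 0 = f y by rewrite /phi scale0r addr0.
have [a0|a0] := leP 0 a.
  have [||t ta E] := seg 0 a a0; rewrite ?normr0//.
  by exists t => //; rewrite -phi0 -/(phi a) E subr0 mulrC.
have [||t ta E] := seg a 0 (ltW a0); rewrite ?normr0//.
by exists t => //; rewrite -phi0 -/(phi a) -opprB E sub0r mulrN opprK mulrC.
Qed.

(* From [x] to [x + h] one moves along one coordinate direction at a time; the mean
   value theorem applies to each step. *)
Lemma differentiable_partials V (f : V -> R) (x : V) : findim V ->
  (\forall y \near x, forall v, derivable f y v) ->
  (forall v, {for x, continuous ('D_v f)}) ->
  differentiable f x.
Proof.
move=> fV df cf; have [I [b [c [cc bc]]]] := fV.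
have /choice[k kP] : forall i, exists k, 0 < k /\ forall h, `|c i h| <= k * `|h|.
  by move=> i; have [k k0 ck] := linear_lipschitz (cc i); exists k.
pose S s h : V := \sum_(i <- s) c i h *: b i.
pose M s : R := \sum_(i <- s) k i * `|b i|.
have SM s h : `|S s h| <= M s * `|h|.
  rewrite /S /M mulr_suml (le_trans (ler_norm_sum _ _ _))//.
  apply: ler_sum => i _; rewrite normrZ mulrAC ler_wpM2r//; exact: (kP i).2.
have M0 s : 0 <= M s.
  by apply: sumr_ge0 => i _; rewrite mulr_ge0// ltW// (kP i).1.
have key s e : 0 < e -> \forall h \near 0,
    `|f (x + S s h) - f x - \sum_(i <- s) c i h * 'D_(b i) f x| <= e * `|h|.
  elim: s e => [|i s IH] e e0.
    near=> h; rewrite /S !big_nil addr0 subrr subr0 normr0.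
    by rewrite mulr_ge0// ltW.
  (* Half of [e] pays for the step along [b i], half for the induction hypothesis; the division by
     [k i] compensates [|c i h| <= k i * |h|]. *)
  have e20 : 0 < e / 2 by rewrite divr_gt0.
  have ek : 0 < e / 2 / k i by rewrite divr_gt0// (kP i).1.
  have : \forall y \near x, (forall v, derivable f y v) /\
      `|'D_(b i) f x - 'D_(b i) f y| < e / 2 / k i.
    near=> y; split; first by near: y.
    near: y; have /cvgrPdist_lt := cf (b i); exact.
  move=> /nbhs_ballP[d d0 H].
  near=> h.
  (* [M] bounds the displacement, so the points met in this step stay in the ball of radius [d]; the
     added 1 keeps the denominator positive even if [M] vanishes. *)
  have hd : `|h| < d / (M (i :: s) + 1).
    near: h; apply: nbhs0_lt; rewrite divr_gt0// ltr_wpDl//.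
  have hM : M (i :: s) * `|h| < d.
    rewrite (@le_lt_trans _ _ ((M (i :: s) + 1) * `|h|))//.
      by rewrite ler_wpM2r// lerDl.
    by rewrite mulrC -ltr_pdivlMr// ltr_wpDl.
  have near_x t : `|t| <= `|c i h| -> ball x d (x + S s h + t *: b i).
    move=> tc; rewrite -ball_normE/= -addrA opprD addNKr normrN.
    apply: le_lt_trans hM; rewrite (le_trans (ler_normD _ _))// normrZ.
    rewrite /M big_cons mulrDl addrC lerD//.
    by rewrite mulrAC ler_wpM2r// (le_trans tc)// (kP i).2.
  have [|t tc E] := @MVT_dir V f (x + S s h) (b i) (c i h).
    by move=> t /near_x/H[/(_ (b i))].
  have [_ /= Ht] := H _ (near_x _ tc).
  rewrite /= in E.
  rewrite /S !big_cons -/(S s h) [_ + S s h]addrC [x + (_ + _)]addrA.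
  rewrite -(subrK (f (x + S s h)) (f _)) E.
  set D0 := derive f x _ in Ht *; set D := derive f _ _ in Ht *.
  set T := \sum_(_ <- _) _.
  rewrite (_ : _ - _ = c i h * (D - D0) + (f (x + S s h) - f x - T)); last by ring.
  rewrite (le_trans (ler_normD _ _))// [e]splitr mulrDl lerD//; last first.
    by rewrite {}/T {Ht E}; clear D; near: h; exact: (IH _ e20).
  rewrite normrM distrC (@le_trans _ _ ((k i * `|h|) * (e / 2 / k i)))//.
    by rewrite ler_pM// ?(kP i).2// ltW.
  by rewrite mulrC mulrA divfK// gt_eqF// (kP i).1.
pose L h : R := \sum_i c i h * 'D_(b i) f x.
have Llin : linear L.
  move=> a u v; rewrite /L scaler_sumr -big_split/=; apply: eq_bigr => i _.
  by rewrite linearP mulrDl -mulrA.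
have [L' L'E] := linear_fun_ex Llin.
have : is_diff x f L'.
  apply: diff_eps => [|e e0]; first exact: findim_linear_continuous.
  near=> h; rewrite L'E [h + x]addrC {1}[h]bc.
  by near: h; exact: (key (index_enum I) e e0).
by move=> H; exact: ex_diff.
Unshelve. all: by end_near. Qed.

Lemma is_derive_comp_linear U V W (L : {linear V -> W}) (f : U -> V) x v :
  continuous L -> derivable f x v -> is_derive x v (fun y => L (f y)) (L ('D_v f x)).
Proof.
move=> cL df.
pose q (h : R) := h^-1 *: ((f \o shift x) (h *: v) - f x).
have cq : q h @[h --> 0^'] --> 'D_v f x by exact: df.
have cLq : L (q h) @[h --> 0^'] --> L ('D_v f x) by apply: cvg_comp cq _; exact: cL.
have E : (fun h : R => h^-1 *: (((fun y => L (f y)) \o shift x) (h *: v) - L (f x))) =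
    (fun h => L (q h)).
  by apply/funext => h; rewrite /q [RHS]linearZ [L (_ - _)]linearB.
split; first by rewrite /derivable E; apply/cvg_ex; exists (L ('D_v f x)).
by rewrite /derive E; apply: cvg_lim => //; exact: norm_hausdorff.
Qed.

Lemma differentiable_partials_vec V W (f : V -> W) (x : V) :
  findim V -> findim W ->
  (\forall y \near x, forall v, derivable f y v) ->
  (forall v, {for x, continuous ('D_v f)}) ->
  differentiable f x.
Proof.
move=> fV [I [b [c [cc bc]]]] df cf.
rewrite (_ : f = \sum_i (fun y => c i (f y) *: b i)); last first.
  by apply/funext => y; rewrite fct_sumE {1}[f y]bc.
elim/big_ind : _ => [|g h dg dh|i _].
- exact: differentiable_cst.
- exact: differentiableD.
apply: differentiableZl; apply: differentiable_partials => //.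
  near=> y => v; have dfy : derivable f y v by move: v; near: y.
  by have [] := is_derive_comp_linear (cc i) dfy.
move=> v; apply: (@near_eq_cont _ _ (fun y => c i ('D_v f y))).
  near=> y; have dfy : derivable f y v by move: v; near: y.
  by have [_ ->] := is_derive_comp_linear (cc i) dfy.
by apply: continuous_comp; [exact: cf|exact: cc].
Unshelve. all: by end_near. Qed.

(** Openness of [U] turns the pointwise conditions into conditions near [x], and continuity of the
    partial derivatives upgrades derivability along vectors to total differentiability. *)
Lemma smooth_on_at V W (U : set V) (f : V -> W) : findim V -> findim W ->
  open U -> smooth_on U f -> forall x, U x -> smooth_at f x.
Proof.
move=> fV fW oU sf x Ux k; elim: k f sf x Ux => [|k IH] f sf x Ux.
  have : nbhs x U by exact: open_nbhs_nbhs.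
  by apply: filterS => y /(sf [::])[].
have nU : nbhs x U by exact: open_nbhs_nbhs.
split=> [|v]; last first.
  apply: IH => // s y Uy; have := sf (rcons s v) y Uy.
  (* [iter_derive] applies the last direction of the list first, so [v] has to be appended. *)
  by rewrite (_ : iter_derive (rcons s v) f = iter_derive s ('D_v f))//; elim: s => //= w s ->.
have nnU := near_join nU.
near=> y; apply: differentiable_partials_vec => //.
  have : nbhs y U by near: y.
  by apply: filterS => z Uz v; exact: (sf [::] z Uz).2.
by move=> v; have /(sf [:: v])[] : U y by near: y.
Unshelve. all: by end_near. Qed.

Lemma smooth_at_on V W (U : set V) (f : V -> W) :
  (forall x, U x -> smooth_at f x) -> smooth_on U f.
Proof.
move=> sf s x Ux.
have H : smooth_at (iter_derive s f) x.
  by elim: s => [|v s IH] /=; [exact: sf|exact: ((smooth_atP _ _).1 IH).2].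
split=> [|v]; first exact: smooth_at_cont.
exact/diff_derivable/smooth_at_diff.
Qed.

End ContinuousPartials.

(** * Smoothness of determinants and inverse matrices *)

Section MatrixSmooth.
Context {R : realType}.
Implicit Types U V W : normedModType R.

Lemma Ck_coord k V m n (M : V -> 'M[R]_(m, n)) x i j :
  Ck k M x -> Ck k (fun y => M y i j) x.
Proof.
have lin : linear (fun A : 'M[R]_(m, n) => A i j) by move=> a A B; rewrite !mxE.
have [L LE] := linear_fun_ex lin.
move=> kM; have := @Ck_comp_linear R k V _ _ L M x; rewrite LE; apply => //.
exact: coord_continuous.
Qed.

Lemma Ck_mx k V m n (M : V -> 'M[R]_(m, n)) x :
  (forall i j, Ck k (fun y => M y i j) x) -> Ck k M x.
Proof.
move=> kM; rewrite (_ : M = fun y => \sum_i \sum_j M y i j *: delta_mx i j).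
  by apply: Ck_sum => i _; apply: Ck_sum => j _; exact: Ck_scalel.
by apply/funext => y; exact: matrix_sum_delta.
Qed.

Lemma Ck_prod k V (I : Type) (r : seq I) (P : pred I) (f : I -> V -> R) x :
  (forall i, P i -> Ck k (f i) x) -> Ck k (fun y => \prod_(i <- r | P i) f i y) x.
Proof.
move=> kf; elim: r => [|i r IH].
  rewrite (_ : (fun y => _) = cst 1); first exact: Ck_cst.
  by apply/funext => y; rewrite big_nil.
rewrite (_ : (fun y => _) = fun y => if P i then f i y * \prod_(j <- r | P j) f j y
  else \prod_(j <- r | P j) f j y); last by apply/funext => y; rewrite big_cons.
by case Pi: (P i) => //; apply: CkM => //; exact: kf.
Qed.

Lemma Ck_det k V n (M : V -> 'M[R]_n) x : Ck k M x -> Ck k (fun y => \det (M y)) x.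
Proof.
move=> kM; apply: Ck_sum => s _; apply: CkM; first exact: Ck_cst.
by apply: Ck_prod => i _; exact: Ck_coord.
Qed.

Lemma Ck_mulmx k V m n p (M : V -> 'M[R]_(m, n)) (N : V -> 'M[R]_(n, p)) x :
  Ck k M x -> Ck k N x -> Ck k (fun y => M y *m N y) x.
Proof.
move=> kM kN; apply: Ck_mx => i j.
rewrite (_ : (fun y => _) = fun y => \sum_l M y i l * N y l j).
  by apply: Ck_sum => l _; apply: CkM; exact: Ck_coord.
by apply/funext => y; rewrite mxE.
Qed.

Lemma Ck_invmx k V n (M : V -> 'M[R]_n) x : M x \in unitmx ->
  Ck k M x -> Ck k (fun y => invmx (M y)) x.
Proof.
move=> uM kM.
have cM := Ck_det kM.
(* Cramer's formula describes [invmx] only at invertible matrices, hence for [y] near [x]. *)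
apply: (@near_eq_Ck _ k _ _ (fun y => (\det (M y))^-1 *: \adj (M y))).
  have cdet : {for x, continuous (fun y => \det (M y))}.
    case: k cM {kM} => [/nbhs_singleton //|k [/nbhs_singleton H _]].
    exact: differentiable_continuous.
  have dx0 : \det (M x) != 0 by rewrite -unitfE.
  have : \forall y \near x, \det (M y) != 0 by exact: cvgr_neq0 cdet dx0.
  by apply: filterS => y dy; rewrite /invmx unitmxE unitfE dy.
apply: CkZ; first exact: findim_mx.
  by apply: CkV => //; rewrite -unitfE.
apply: Ck_mx => i j.
rewrite (_ : (fun y => _) = fun y =>
  (-1) ^+ (j + i) * \det (row' j (col' i (M y)))); last first.
  by apply/funext => y; rewrite mxE.
apply: CkM; first exact: Ck_cst.
apply: Ck_det; apply: Ck_mx => i' j'.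
rewrite (_ : (fun y => _) = fun y => M y (lift j i') (lift i j')); first exact: Ck_coord.
by apply/funext => y; rewrite !mxE.
Qed.

End MatrixSmooth.

(** * Inverse functions, submersions and maps of constant rank *)

(* The library declares matrices complete before it declares them normed, so that
   it lacks their structure of [completeNormedModType]. *)
HB.instance Definition _ (R : realType) m n :=
  Uniform_isComplete.Build 'M[R]_(m, n) cauchy_cvg.

Section InverseFunction.
Context {R : realType}.
Implicit Types U V W : normedModType R.

(** As [MVT_dir] only provides [|t| <= 1], the point may lie off the segment and convexity of the
    ball is not enough. The factor 3 pays for the three norms in the triangle inequality. *)
Lemma ball_segment V (x u v : V) (d t : R) : ball x (d / 3) u -> ball x (d / 3) v ->
  `|t| <= 1 -> ball x d (u + t *: (v - u)).
Proof.
rewrite -!ball_normE/= => xu xv t1.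
have -> : x - (u + t *: (v - u)) = (x - u) - t *: ((x - u) - (x - v)).
  by rewrite opprD addrA opprB [_ + (v - x)]addrC subrKA.
rewrite (le_lt_trans (ler_normB _ _))// normrZ.
rewrite (@le_lt_trans _ _ (`|x - u| + (`|x - u| + `|x - v|)))//; last by lra.
by rewrite lerD// (le_trans _ (ler_normB _ _))// ler_piMl.
Qed.

(** By the mean value theorem the increment is a derivative at an intermediate point, whose partial
    derivatives are close to those at [x]. Moving both points, unlike in plain differentiability, is
    what makes maps contractions. *)
Lemma strict_diff_scalar V (f : V -> R) x e : findim V -> smooth_at f x -> 0 < e ->
  \forall p \near (x, x), `|f p.1 - f p.2 - 'd f x (p.1 - p.2)| <= e * `|p.1 - p.2|.
Proof.
move=> [I [b [c [cc bc]]]] sf e0.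
have /choice[k kP] : forall i, exists k, 0 < k /\ forall h, `|c i h| <= k * `|h|.
  by move=> i; have [k k0 ck] := linear_lipschitz (cc i); exists k.
pose K := \sum_i k i.
have K0 : 0 <= K by apply: sumr_ge0 => i _; rewrite ltW// (kP i).1.
have [df kf] := (smooth_atP _ _).1 sf.
have : \forall y \near x, differentiable f y /\
    forall i, `|'D_(b i) f x - 'D_(b i) f y| < e / (K + 1).
  near=> y; split; first by near: y.
  move=> i; move: i; near: y; apply: filter_forall => i.
  have /cvgrPdist_lt := smooth_at_cont (kf (b i)); apply.
  by rewrite divr_gt0// ltr_wpDl.
move=> /nbhs_ballP[d d0 H].
have d30 : 0 < d / 3 by rewrite divr_gt0.
apply/nbhs_ballP; exists (d / 3) => //= -[u v] [/= xu xv].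
have near_x (t : R) : `|t| <= `|1| -> ball x d (v + t *: (u - v)).
  by rewrite normr1; exact: ball_segment.
have [|t t1 E] := @MVT_dir R V f v (u - v) 1.
  by move=> t /near_x/H[? _]; exact: diff_derivable.
rewrite scale1r subrKC mul1r in E; rewrite E.
have [dft Ht] := H _ (near_x _ t1).
have dfx := nbhs_singleton df.
rewrite deriveE//; set z := v + _ in dft Ht *.
have ce (g : {linear V -> R}) h : g h = \sum_i c i h * g (b i).
  by rewrite {1}[h]bc linear_sum; apply: eq_bigr => i _; rewrite linearZ.
rewrite (ce ('d f z)) (ce ('d f x)) -sumrB (le_trans (ler_norm_sum _ _ _))//.
apply: (@le_trans _ _ (\sum_i (k i * `|u - v|) * (e / (K + 1)))).
  apply: ler_sum => i _; rewrite -mulrBr normrM ler_pM ?(kP i).2//.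
  by rewrite distrC -!deriveE// ltW.
rewrite -!mulr_suml -/K mulrAC ler_wpM2r//.
by rewrite mulrCA ler_piMr ?ltW// ltr_pdivrMr ?mul1r ?ltrDl// ltr_wpDl.
Unshelve. all: by end_near. Qed.

(** The mean value theorem fails for vector values, so the scalar case is applied to each coordinate
    and the errors are summed. *)
Lemma strict_diff V W (f : V -> W) x e : findim V -> findim W -> smooth_at f x ->
  0 < e ->
  \forall p \near (x, x), `|f p.1 - f p.2 - 'd f x (p.1 - p.2)| <= e * `|p.1 - p.2|.
Proof.
move=> fV [I [b [c [cc bc]]]] sf e0.
pose K := \sum_i `|b i|.
have K0 : 0 <= K by apply: sumr_ge0.
near=> p; rewrite [X in `|X|]bc (le_trans (ler_norm_sum _ _ _))//.
apply: (@le_trans _ _ (\sum_i (e / (K + 1) * `|p.1 - p.2|) * `|b i|)); last first.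
  rewrite -mulr_sumr -/K mulrAC ler_wpM2r// -mulrA ler_piMr ?ltW//.
  by rewrite mulrC ltr_pdivrMr ?mul1r ?ltrDl// ltr_wpDl.
apply: ler_sum => i _; rewrite normrZ ler_wpM2r//.
move: i; near: p; apply: filter_forall => i.
have sci : smooth_at (fun y => c i (f y)) x.
  by move=> k; exact: Ck_comp_linear.
have eK0 : 0 < e / (K + 1) by rewrite divr_gt0// ltr_wpDl.
have := strict_diff_scalar fV sci eK0.
apply: filterS => -[u v] /=; apply: le_trans.
rewrite (@diff_comp _ _ _ _ f (c i))//; last 2 first.
- exact: smooth_at_diff.
- exact: linear_differentiable.
by rewrite /= diff_lin// !linearB.
Unshelve. all: by end_near. Qed.

(* The easy half of the inverse function theorem: [h] is already known to exist and
   to be continuous. *)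
Lemma diff_lift U V W (h : U -> V) (F : V -> W) (L : {linear W -> V}) x :
  continuous L -> (forall v, L ('d F (h x) v) = v) -> differentiable F (h x) ->
  {for x, continuous h} -> differentiable (F \o h) x ->
  is_diff x h (L \o 'd (F \o h) x).
Proof.
move=> cL LF dF ch dk; set k := F \o h in dk *.
have cT : continuous (L \o 'd k x).
  by move=> y; apply: continuous_comp; [exact: diff_continuous|exact: cL].
have [K K0 LK] := linear_lipschitz cL.
have [KT KT0 TK] := linear_lipschitz cT.
apply: diff_eps => // e e0.
(* With [e1 <= 1 / 2] the increment [d] of [h] can be absorbed, giving [|d| <= (2 * KT + 2) * |u|];
   the total error [e1 * (|u| + |d|)] is then at most [e1 * (3 + 2 * KT) * |u|]. *)
pose e1 := Num.min (1 / 2) (e / (3 + 2 * KT)).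
have e10 : 0 < e1 by rewrite lt_min divr_gt0//= divr_gt0// addr_gt0// mulr_gt0.
have e12 : e1 <= 1 / 2 by rewrite ge_min lexx.
have e1e : e1 * (3 + 2 * KT) <= e.
  by rewrite -ler_pdivlMr ?addr_gt0 ?mulr_gt0// ge_min lexx orbT.
have e1K : 0 < e1 / K by rewrite divr_gt0.
have cd : h (u + x) - h x @[u --> 0] --> (0 : V).
  rewrite -(subrr (h x)); apply: cvgB; last exact: cvg_cst.
  by move=> P /ch; exact: near0_shift.
near=> u; set d := h (u + x) - h x.
have A1 : `|L (k (u + x) - k x - 'd k x u)| <= e1 * `|u|.
  rewrite (le_trans (LK _))// -ler_pdivlMl// mulrA [K^-1 * _]mulrC.
  by near: u; exact: diff_epsE.
have A2 : `|L (k (u + x) - k x - 'd F (h x) d)| <= e1 * `|d|.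
  rewrite (le_trans (LK _))// -ler_pdivlMl// mulrA [K^-1 * _]mulrC.
  have -> : k (u + x) - k x = F (d + h x) - F (h x) by rewrite /d subrK.
  by rewrite {}/d; near: u; apply: (cd _ (diff_epsE dF e1K)).
(* Since [L] undoes ['d F (h x)], the error of [h] is the image under [L] of the difference of the
   errors of [F \o h] and of [F]. *)
have E : d - (L \o 'd k x) u =
    L (k (u + x) - k x - 'd k x u) - L (k (u + x) - k x - 'd F (h x) d).
  by rewrite -linearB opprD opprK addrACA subrr add0r addrC linearB LF.
have B1 : `|d - (L \o 'd k x) u| <= e1 * `|u| + e1 * `|d|.
  by rewrite E (le_trans (ler_normB _ _))// lerD.
have B2 : `|d| <= `|d - (L \o 'd k x) u| + KT * `|u|.
  rewrite -{1}[d](subrK ((L \o 'd k x) u)) (le_trans (ler_normD _ _))// lerD//.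
  exact: TK.
have u0 := normr_ge0 u; have d0 := normr_ge0 d.
have B3 : e1 * `|d| <= 1 / 2 * `|d| by rewrite ler_wpM2r.
have B4 : e1 * `|u| <= 1 / 2 * `|u| by rewrite ler_wpM2r.
have B5 : `|d| <= (2 * KT + 2) * `|u| by lra.
rewrite (le_trans B1)// (@le_trans _ _ (e1 * `|u| + e1 * ((2 * KT + 2) * `|u|)))//.
  by rewrite lerD2l ler_wpM2l// ltW.
rewrite (@le_trans _ _ ((e1 * (3 + 2 * KT)) * `|u|))//; last by rewrite ler_wpM2r.
by rewrite le_eqVlt; apply/orP; left; apply/eqP; ring.
Unshelve. all: by end_near. Qed.

(* The partial derivatives, rather than [jacobian], so that [jac f] is smooth
   wherever [f] is. *)
Definition jac n m (f : 'rV[R]_n -> 'rV[R]_m) (z : 'rV[R]_n) : 'M[R]_(n, m) :=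
  \matrix_(i, j) 'D_(delta_mx 0 i) f z 0 j.

Lemma diff_jac n m (f : 'rV[R]_n -> 'rV[R]_m) z v : differentiable f z ->
  'd f z v = v *m jac f z.
Proof.
move=> df; rewrite {1}[v]row_sum_delta linear_sum mulmx_sum_row.
apply: eq_bigr => i _; rewrite linearZ/= -deriveE//; congr (_ *: _).
by apply/rowP => j; rewrite !mxE.
Qed.

Lemma near_eq_jac n m (f g : 'rV[R]_n -> 'rV[R]_m) z :
  (\forall w \near z, f w = g w) -> jac f z = jac g z.
Proof.
by move=> fg; apply/matrixP => i j; rewrite !mxE (near_eq_derive _ fg).
Qed.

Lemma smooth_jac n m (f : 'rV[R]_n -> 'rV[R]_m) z : smooth_at f z ->
  smooth_at (jac f) z.
Proof.
move=> sf k; apply: Ck_mx => i j.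
rewrite (_ : (fun y => _) = fun y => 'D_(delta_mx 0 i) f y 0 j); last first.
  by apply/funext => y; rewrite mxE.
by apply: Ck_coord; apply: ((smooth_atP _ _).1 sf).2.
Qed.

Lemma jac_unit_near n (f : 'rV[R]_n -> 'rV[R]_n) z : smooth_at f z ->
  jac f z \in unitmx -> \forall y \near z, jac f y \in unitmx.
Proof.
move=> sf; rewrite unitmxE unitfE => d0.
have cdet : {for z, continuous (fun y => \det (jac f y))}.
  by apply: smooth_at_cont => k; apply: Ck_det; exact: smooth_jac.
have : \forall y \near z, \det (jac f y) != 0 by exact: cvgr_neq0 cdet d0.
by apply: filterS => y; rewrite unitmxE unitfE.
Qed.

(* ['D_v h] is a smooth expression in [h] and ['D_v (F \o h)], so [h] gains one
   order of differentiability at a time. *)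
Lemma smooth_lift_jac V m (h : V -> 'rV[R]_m) (F : 'rV[R]_m -> 'rV[R]_m) x :
  jac F (h x) \in unitmx -> smooth_at F (h x) ->
  (\forall y \near x, {for y, continuous h}) ->
  smooth_at (fun y => F (h y)) x -> smooth_at h x.
Proof.
move=> uF sF ch sk; pose kk y := F (h y).
have chx : {for x, continuous h} := nbhs_singleton ch.
have nF : \forall y \near x, differentiable F (h y).
  exact: (chx _ (smooth_at_near_diff sF)).
have nu : \forall y \near x, jac F (h y) \in unitmx.
  exact: (chx _ (jac_unit_near sF uF)).
have nk : \forall y \near x, differentiable kk y by exact: smooth_at_near_diff.
have dh : \forall y \near x, is_diff y h (fun v => 'd kk y v *m invmx (jac F (h y))).
  near=> y.
  have [L LE] : exists L : {linear 'rV[R]_m -> 'rV[R]_m},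
      L = (fun v => v *m invmx (jac F (h y))) :> (_ -> _).
    by apply: linear_fun_ex => a u v; rewrite mulmxDl -scalemxAl.
  have dFy : differentiable F (h y) by near: y.
  have uy : jac F (h y) \in unitmx by near: y.
  have := @diff_lift V 'rV[R]_m 'rV[R]_m h F L y.
  rewrite /comp LE; apply.
  - by rewrite -LE; apply: findim_linear_continuous; exact: findim_mx.
  - by move=> v; rewrite (diff_jac _ dFy) (mulmxK uy).
  - by [].
  - by near: y.
  - by near: y.
move=> k; elim: k => [//|k IH].
split=> [|v]; first by apply: filterS dh => y [].
apply: (@near_eq_Ck _ k _ _ (fun y => 'D_v kk y *m invmx (jac F (h y)))).
  near=> y.
  have [dhy E] : is_diff y h (fun v => 'd kk y v *m invmx (jac F (h y))) by near: y.
  have dky : differentiable kk y by near: y.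
  have E1 := deriveE v dky.
  have E2 : 'D_v h y = 'd kk y v *m invmx (jac F (h y)).
    rewrite (deriveE v dhy).
    exact: (congr1 (fun f => f v) E).
  by rewrite E1 E2.
apply: Ck_mulmx; first exact: ((smooth_atP _ _).1 sk).2.
apply: Ck_invmx => //.
apply: (@Ck_comp _ _ _ _ _ h (jac F)) => //; try exact: findim_mx.
exact: smooth_jac.
Unshelve. all: by end_near. Qed.

Lemma near_lipschitz_cont V W (f : V -> W) y k : 0 < k ->
  (\forall z \near y, `|f y - f z| <= k * `|y - z|) -> {for y, continuous f}.
Proof.
move=> k0 fk; apply/cvgrPdist_le => e e0.
near=> z; apply: (@le_trans _ _ (k * `|y - z|)); first by near: z.
rewrite mulrC -ler_pdivlMr//; near: z.
apply/nbhs_ballP; exists (e / k); first by rewrite /= divr_gt0.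
by move=> z; rewrite -ball_normE/= => /ltW.
Unshelve. all: by end_near. Qed.

(* [G y] is the fixed point of the contraction [u |-> y + u - F u]. *)
Lemma inverse_function n (F : 'rV[R]_n -> 'rV[R]_n) x :
  smooth_at F x -> (forall v, 'd F x v = v) ->
  exists G : 'rV[R]_n -> 'rV[R]_n,
    [/\ G (F x) = x, \forall y \near F x, F (G y) = y,
        \forall z \near x, G (F z) = z & smooth_at G (F x)].
Proof.
move=> sF dF.
(* Near [x] the map [F - id] is Lipschitz with constant 1/2. This yields both the injectivity
   estimate [inj] and the contraction [T]. *)
have [d d0 dP] : exists2 d : R, 0 < d & forall u v, `|x - u| < d -> `|x - v| < d ->
    `|F u - F v - (u - v)| <= 1 / 2 * `|u - v|.
  have h0 : 0 < 1 / 2 :> R by rewrite divr_gt0.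
  have /nbhs_ballP[d d0 H] := strict_diff (findim_mx _ _) (findim_mx _ _) sF h0.
  exists d => // u v xu xv; have := H (u, v); rewrite /= dF; apply.
  by split; rewrite -ball_normE.
have inj u v : `|x - u| < d -> `|x - v| < d -> `|u - v| <= 2 * `|F u - F v|.
  move=> xu xv; have H := dP _ _ xu xv.
  have : `|u - v| <= `|F u - F v| + `|F u - F v - (u - v)|.
    by rewrite -{1}[u - v](subKr (F u - F v)) ler_normB.
  by have := normr_ge0 (u - v); lra.
have d20 : 0 < d / 2 by rewrite divr_gt0.
have d40 : 0 < d / 4 by rewrite divr_gt0.
pose B := [set u | `|x - u| <= d / 2].
have Bd u : B u -> `|x - u| < d by rewrite /B/= => /le_lt_trans; apply; lra.
have xx : `|x - x| < d by rewrite subrr normr0.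
(* The bound on [y] stands inside the existential so that choice yields a total [G]; outside the
   ball any witness will do, here [x]. *)
have ex_sol y : exists u, `|F x - y| < d / 4 -> `|x - u| <= d / 2 /\ F u = y.
  have [yd|] := pselect (`|F x - y| < d / 4); last by exists x.
  pose T u := y + u - F u.
  (* The closed ball of radius [d / 2] is preserved because [d / 4 + (1 / 2) * (d / 2) = d / 2]. *)
  have TB : set_fun B B T.
    move=> u Bu; rewrite /B/= /T.
    have -> : x - (y + u - F u) = F x - y + (F u - F x - (u - x)).
      by apply/rowP => i; rewrite !mxE; ring.
    rewrite (le_trans (ler_normD _ _))//.
    have := dP _ _ (Bd _ Bu) xx; rewrite [`|u - x|]distrC.
    by move: Bu yd; rewrite /B/=; lra.
  have [TBf TBfE] : exists f : {fun B >-> B}, f = T :> (_ -> _).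
    pose fM := isFun.Build _ _ B B T TB.
    pose f : {fun B >-> B} := HB.pack T fM.
    by exists f.
  have ctr : is_contraction TBf.
    exists (1 / 2)%:nng; split => /=; first by lra.
    move=> -[u v] /= [Bu Bv]; rewrite TBfE /T.
    have -> : y + u - F u - (y + v - F v) = - (F u - F v - (u - v)).
      by apply/rowP => i; rewrite !mxE; ring.
    by rewrite normrN; apply: dP; exact: Bd.
  have [||u Bu uE] := banach_fixed_point ctr.
  - exact: closed_closed_ball_.
  - by exists x; rewrite /B/= subrr normr0 ltW.
  exists u => _; split=> //; rewrite TBfE /T in uE.
  apply/eqP; rewrite -subr_eq0; apply/eqP; move: uE => /(congr1 (fun w => w - u)).
  rewrite subrr => /esym E; rewrite -[RHS]oppr0 -E.
  by apply/rowP => i; rewrite !mxE; ring.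
have [G GP] := choice ex_sol.
have nearF (y : 'rV[R]_n) (e : R) : 0 < e -> \forall z \near y, `|y - z| < e.
  by move=> e0; apply/nbhs_ballP; exists e => // z; rewrite -ball_normE.
have GFx : G (F x) = x.
  have [|Gd GF] := GP (F x); first by rewrite subrr normr0.
  have := inj _ _ (Bd _ Gd) xx; rewrite GF subrr normr0 mulr0 normr_le0 subr_eq0.
  by move/eqP.
have FG : \forall y \near F x, F (G y) = y.
  by apply: filterS (nearF (F x) _ d40) => y /GP[].
exists G; split => //.
  have cF := smooth_at_cont sF.
  have nFz := cF _ (nearF (F x) _ d40).
  near=> z.
  have [|Gd GF] := GP (F z); first by near: z.
  have zd : `|x - z| < d by near: z; exact: nearF.
  have := inj _ _ (Bd _ Gd) zd; rewrite GF subrr normr0 mulr0 normr_le0 subr_eq0.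
  by move/eqP.
(* [G] lifts the identity through [F], and it is continuous near [F x] because [inj] makes it
   Lipschitz with constant 2. *)
apply: (@smooth_lift_jac _ _ G F).
- rewrite GFx; suff -> : jac F x = 1%:M by exact: unitmx1.
  apply/row_matrixP => i; rewrite !rowE -diff_jac ?dF ?mulmx1//.
  exact: smooth_at_diff.
- by rewrite GFx.
- have H : \forall y \near F x, \forall z \near y, `|F x - z| < d / 4.
    by apply: near_join; exact: nearF.
  near=> y; apply: (@near_lipschitz_cont _ _ G y 2) => //.
  have yd : `|F x - y| < d / 4.
    have : \forall z \near y, `|F x - z| < d / 4 by near: y.
    by move/nbhs_singleton.
  have [Gyd GyE] := GP _ yd.
  near=> z.
  have zd : `|F x - z| < d / 4 by near: z; near: y.
  have [Gzd GzE] := GP _ zd.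
  by have := inj _ _ (Bd _ Gyd) (Bd _ Gzd); rewrite GyE GzE.
- apply: (@near_eq_smooth _ _ _ id); last by move=> k; exact: Ck_id.
  by near=> y; apply/esym; near: y.
Unshelve. all: by end_near. Qed.

End InverseFunction.

(** * Lifts through immersions, sections of submersions, constant rank *)

Section SubmersionsAndConstantRank.
Context {R : realType}.
Implicit Types U V W : normedModType R.

Lemma linear_mulmx_ex m n p (B : 'M[R]_(n, p)) :
  exists2 L : {linear 'M[R]_(m, n) -> 'M[R]_(m, p)},
    L = (fun v => v *m B) :> (_ -> _) & continuous L.
Proof.
have [|L LE] := @linear_fun_ex R 'M[R]_(m, n) 'M[R]_(m, p) (fun v => v *m B).
  by move=> a u v; rewrite mulmxDl -scalemxAl.
by exists L => //; apply: findim_linear_continuous; exact: findim_mx.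
Qed.

(** Coordinates embed [W] into a space of row vectors, where an injective map becomes a matrix with
    free rows, inverted on the right by [pinvmx]. *)
Lemma linear_left_inverse m W (f : {linear 'rV[R]_m -> W}) :
  findim W -> injective f ->
  exists2 L : {linear W -> 'rV[R]_m}, continuous L & forall v, L (f v) = v.
Proof.
move=> fW finj; have [I [b [c [cc bc]]]] := fW.
pose C (w : W) : 'rV[R]_#|I| := \row_i c (enum_val i) w.
have Clin : linear C by move=> a u v; apply/rowP => i; rewrite !mxE linearP.
have Cinj w : C w = 0 -> w = 0.
  move=> Cw; rewrite [w]bc big1// => i _.
  move: (congr1 (fun M : 'rV[R]_#|I| => M 0 (enum_rank i)) Cw).
  by rewrite !mxE enum_rankK => ->; rewrite scale0r.
have CfL : linear (C \o f) by move=> a u v; rewrite /= linearP Clin.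
have [Cf CfE] := linear_fun_ex CfL.
pose D := lin1_mx Cf.
have DE v : v *m D = C (f v) by rewrite mul_rV_lin1 CfE.
have Dfree : row_free D.
  apply: inj_row_free => v; rewrite DE => /Cinj; rewrite -(linear0 f).
  exact: finj.
have [|L LE] := @linear_fun_ex R W 'rV[R]_m (fun w => C w *m pinvmx D).
  by move=> a u v; rewrite Clin mulmxDl -scalemxAl.
exists L; first exact: findim_linear_continuous.
by move=> v; rewrite LE -DE -mulmxA mulmxVp// mulmx1.
Qed.

Lemma jac_comp_linear m n W (L : {linear W -> 'rV[R]_n}) (f : 'rV[R]_m -> W) x :
  continuous L -> differentiable f x ->
  forall v, v *m jac (fun y => L (f y)) x = L ('d f x v).
Proof.
move=> cL df v; have dL : differentiable L (f x) by exact: linear_differentiable.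
have dLf : differentiable (L \o f) x by exact: differentiable_comp.
by rewrite -diff_jac// (@diff_comp _ _ _ _ f L)//= diff_lin.
Qed.

(** Composing [F] with a left inverse of its differential at [h x] makes the Jacobian there the
    identity, which reduces the claim to equal dimensions. *)
Lemma smooth_lift V W m (h : V -> 'rV[R]_m) (F : 'rV[R]_m -> W) x :
  findim W -> injective ('d F (h x)) -> smooth_at F (h x) ->
  (\forall y \near x, {for y, continuous h}) ->
  smooth_at (fun y => F (h y)) x -> smooth_at h x.
Proof.
move=> fW inj sF ch sk.
have [L cL LF] := linear_left_inverse fW inj.
apply: (@smooth_lift_jac _ _ _ h (fun z => L (F z))) => //.
- suff -> : jac (fun z => L (F z)) (h x) = 1%:M by exact: unitmx1.
  apply/row_matrixP => i; rewrite !rowE jac_comp_linear ?LF ?mulmx1//.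
  exact: smooth_at_diff.
- by move=> k; exact: Ck_comp_linear.
- by move=> k; apply: (@Ck_comp_linear _ k _ _ _ L (fun y => F (h y))).
Qed.

Lemma smooth_at_comp U V W (f : U -> V) (g : V -> W) x :
  findim V -> findim W -> smooth_at f x -> smooth_at g (f x) ->
  smooth_at (fun y => g (f y)) x.
Proof. by move=> fV fW sf sg k; exact: Ck_comp. Qed.

Lemma smooth_affine n p (a : 'rV[R]_p) (B : 'M[R]_(n, p)) y :
  smooth_at (fun v => a + v *m B) y.
Proof.
have [L LE cL] := linear_mulmx_ex 1 B.
by move=> k; apply: CkD; [exact: Ck_cst|rewrite -LE; exact: Ck_linear].
Qed.

Lemma diff_affine n p (a : 'rV[R]_p) (B : 'M[R]_(n, p)) y v :
  'd (fun v => a + v *m B) y v = v *m B.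
Proof.
have [L LE cL] := linear_mulmx_ex 1 B.
rewrite -[X in 'd X _](_ : cst a + (L : 'rV_n -> 'rV_p) = _); last by rewrite LE.
have dL : differentiable L y by exact: linear_differentiable.
have E := congr1 (@^~ v) (diffD (differentiable_cst a y) dL).
have E0 := congr1 (@^~ v) (diff_cst a y).
have E1 := congr1 (@^~ v) (diff_lin y cL).
rewrite /= in E.
rewrite /= in E0 E1.
apply: (etrans E); apply: (etrans (congr2 +%R E0 E1)).
by rewrite LE add0r.
Qed.

(** Preimages of the basis vectors under the differential span an affine slice through [x]. On it
    [P] has the identity as differential, so the inverse function theorem applies. *)
Lemma submersion_section k l (P : 'rV[R]_k -> 'rV[R]_l) x :
  smooth_at P x -> (forall w, exists v, 'd P x v = w) ->
  exists s : 'rV[R]_l -> 'rV[R]_k,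
    [/\ s (P x) = x, smooth_at s (P x) & \forall y \near P x, P (s y) = y].
Proof.
move=> sP surj.
have /choice[b bP] : forall i : 'I_l, exists v, 'd P x v = delta_mx 0 i.
  by move=> i; exact: surj.
pose B := \matrix_i b i.
have dP := smooth_at_diff sP.
have BP v : 'd P x (v *m B) = v.
  rewrite mulmx_sum_row linear_sum {2}[v]row_sum_delta.
  by apply: eq_bigr => i _; rewrite linearZ/= rowK bP.
pose g (y : 'rV[R]_l) := x + y *m B.
have g0 : g 0 = x by rewrite /g mul0mx addr0.
have sg y : smooth_at g y by exact: smooth_affine.
have sF : smooth_at (fun y => P (g y)) 0.
  by apply: smooth_at_comp; rewrite ?g0//; exact: findim_mx.
have [|G [G0 FG GF sG]] := inverse_function sF.
  move=> v; rewrite (@diff_comp _ _ _ _ g P) ?g0//; last exact: smooth_at_diff.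
  by rewrite /= diff_affine BP.
rewrite g0 in G0 FG sG.
exists (fun y => g (G y)); split; [by rewrite G0| |by []].
by apply: smooth_at_comp => //; exact: findim_mx.
Qed.

Lemma jac_comp m n p (f : 'rV[R]_m -> 'rV[R]_n) (g : 'rV[R]_n -> 'rV[R]_p) x :
  differentiable f x -> differentiable g (f x) ->
  jac (fun y => g (f y)) x = jac f x *m jac g (f x).
Proof.
move=> df dg; apply/row_matrixP => i; rewrite !rowE mulmxA.
rewrite -!diff_jac//; last exact: (@differentiable_comp _ _ _ _ f g).
by rewrite (@diff_comp _ _ _ _ f g).
Qed.

(** Equal ranks turn the inclusion of [kermx J] in [kermx (J *m L)] into an equality. *)
Lemma mulmx_rank_eq0 p n m r (q : 'M[R]_(p, n)) (J : 'M[R]_(n, m)) (L : 'M[R]_(m, r)) :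
  \rank (J *m L) = \rank J -> q *m J *m L = 0 -> q *m J = 0.
Proof.
move=> rk; rewrite -mulmxA => /eqP; rewrite -sub_kermx => qK; apply/eqP.
rewrite -sub_kermx (submx_trans qK)//.
have sub : (kermx J <= kermx (J *m L))%MS.
  by rewrite sub_kermx mulmxA mulmx_ker mul0mx.
by rewrite -(geq_leqif (mxrank_leqif_sup sub)) !mxrank_ker rk.
Qed.

(* In the chart [Phi] the map [F *m L] is linear, equal to [w |-> w *m M], and [F]
   has zero derivative along the kernel of [M] because [jac F] and [jac F *m L] have
   the same rank. *)
Lemma constant_rank n m r (F : 'rV[R]_n -> 'rV[R]_m) x :
  smooth_at F x -> (\forall y \near x, \rank (jac F y) = r) ->
  exists (L : 'M[R]_(m, r)) (N : set 'rV[R]_n), nbhs x N /\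
    forall u v, N u -> N v -> F u *m L = F v *m L -> F u = F v.
Proof.
move=> sF rF; have rx := nbhs_singleton rF.
pose A := jac F x.
rewrite -rx -/A in rF *.
(* In the rank factorization of [A], [M] is the first factor, [S] a left inverse of it, and [L] a
   right inverse of the second factor. *)
have [M [L [S [AL SM Mfull]]]] : exists (M : 'M[R]_(n, \rank A)) (L : 'M[R]_(m, \rank A))
      (S : 'M[R]_(\rank A, n)),
    [/\ A *m L = M, S *m M = 1%:M & row_full M].
  have /row_freeP[L LE] : row_free (row_base A) by exact: row_base_free.
  have /row_fullP[S SM] : row_full (col_base A) by exact: col_base_full.
  exists (col_base A), L, S; split=> //; last exact: col_base_full.
  by have := congr1 (mulmx^~ L) (mulmx_base A); rewrite -mulmxA LE mulmx1 => <-.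
exists L.
(* The added term corrects [w *m M] to [F w *m L]. Since [A *m L = M], its differential at [x]
   vanishes, so [Phi] is a local chart. *)
pose Phi w := w + (F w *m L - w *m M) *m S.
have PhiM w : Phi w *m M = F w *m L.
  by rewrite mulmxDl -mulmxA SM mulmx1 subrKC.
have sFx y : smooth_at F y -> smooth_at Phi y.
  move=> sFy k; apply: CkD; first exact: Ck_id.
  apply: Ck_mulmx; last exact: Ck_cst.
  rewrite (_ : (fun w => _) = fun w => F w *m L + w *m (- M)); last first.
    by apply/funext => w; rewrite mulmxN.
  by apply: CkD; apply: Ck_mulmx; [exact: sFy|exact: Ck_cst|exact: Ck_id|exact: Ck_cst].
have jPhi y : differentiable F y -> differentiable Phi y ->
    jac Phi y *m M = jac F y *m L.
  move=> dF dPhi; have [LL LLE cLL] := linear_mulmx_ex 1 L.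
  have [LM LME cLM] := linear_mulmx_ex 1 M.
  have E1 := jac_comp_linear cLM dPhi.
  have E2 := jac_comp_linear cLL dF.
  apply/row_matrixP => i; rewrite !rowE !mulmxA; set e := delta_mx 0 i.
  have e1 : e *m jac Phi y *m M = LM ('d Phi y e) by rewrite LME (diff_jac _ dPhi).
  have e2 : e *m jac F y *m L = LL ('d F y e) by rewrite LLE (diff_jac _ dF).
  have e3 : (fun w => LM (Phi w)) = (fun w => LL (F w)).
    by apply/funext => w; rewrite LME LLE PhiM.
  by rewrite e1 e2 -(E1 e) -(E2 e) e3.
have dFx := smooth_at_diff sF; have sPx := sFx _ sF.
have dPx := smooth_at_diff sPx.
have dPhix v : 'd Phi x v = v.
  have [LL LLE cLL] := linear_mulmx_ex 1 (L *m S).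
  have [LM LME cLM] := linear_mulmx_ex 1 (M *m S).
  have PhiE : Phi = id + (LL \o F - (LM : 'rV_n -> 'rV_n)).
    apply/funext => w; rewrite /Phi LLE LME mulmxBl -!mulmxA.
    by [].
  have dLL : differentiable LL (F x) by exact: linear_differentiable.
  have dLM : differentiable LM x by exact: linear_differentiable.
  have dLLF : differentiable (LL \o F) x by exact: differentiable_comp.
  have did : differentiable (id : 'rV[R]_n -> 'rV[R]_n) x by exact: ex_diff.
  have dB : differentiable (LL \o F - (LM : 'rV_n -> 'rV_n)) x by exact: differentiableB.
  rewrite PhiE; apply: (etrans (congr1 (@^~ v) (diffD did dB))).
  have E0 : 'd (id : 'rV[R]_n -> 'rV[R]_n) x v = v by rewrite (diff_val (f := id)).
  have E1 := congr1 (@^~ v) (diffB dLLF dLM).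
  have E2 := congr1 (@^~ v) (diff_comp dFx dLL).
  have E3 := congr1 (@^~ ('d F x v)) (diff_lin (F x) cLL).
  have E4 := congr1 (@^~ v) (diff_lin x cLM).
  apply: (etrans (congr2 +%R E0 (etrans E1 (congr2 (fun a b => a - b) (etrans E2 E3) E4)))).
  rewrite LLE LME (diff_jac _ dFx) -/A.
  by rewrite -[v *m A *m _]mulmxA [A *m _]mulmxA AL subrr addr0.
clearbody Phi.
have [G [GPx PG GP sG]] := inverse_function sPx dPhix.
have jPx : jac Phi x \in unitmx.
  suff -> : jac Phi x = 1%:M by exact: unitmx1.
  by apply/row_matrixP => i; rewrite !rowE -(diff_jac _ dPx) dPhix mulmx1.
have cG := smooth_at_cont sG; rewrite /prop_for /continuous_at GPx in cG.
have : \forall y \near Phi x, [/\ \forall z \near y, Phi (G z) = z,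
    differentiable G y, \rank (jac F (G y)) = \rank A,
    differentiable F (G y) & differentiable Phi (G y) /\ jac Phi (G y) \in unitmx].
  have pull (P : 'rV[R]_n -> Prop) : (\forall w \near x, P w) ->
    \forall y \near Phi x, P (G y) by move=> HP; exact: (cG P HP).
  have n1 := near_join PG.
  have n2 := smooth_at_near_diff sG.
  have n3 := pull (fun w => \rank (jac F w) = \rank A) rF.
  have n4 := pull (fun w => differentiable F w) (smooth_at_near_diff sF).
  have n5 := pull (fun w => differentiable Phi w) (smooth_at_near_diff sPx).
  have n6 := pull (fun w => jac Phi w \in unitmx) (jac_unit_near sPx jPx).
  apply: filterS (filterI n1 (filterI n2 (filterI n3 (filterI n4 (filterI n5 n6))))).
  by move=> y [? [? [? [? [? ?]]]]].
move=> /nbhs_ballP[d d0 H].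
have d30 : 0 < d / 3 by rewrite divr_gt0.
exists [set w | G (Phi w) = w /\ ball (Phi x) (d / 3) (Phi w)]; split.
  have cPhi := smooth_at_cont sPx.
  have nB := cPhi _ (nbhsx_ballx _ _ d30).
  near=> w; split; first by near: w.
  by near: w.
move=> u v [Gu Bu] [Gv Bv] uv.
rewrite -Gu -Gv; apply/rowP => j.
(* [b] lies in the kernel of [M], and each coordinate of [F \o G] has zero derivative along it on
   the whole segment; the mean value theorem then compares the endpoints. *)
set b := Phi v - Phi u.
have bM : b *m M = 0 by rewrite /b mulmxBl !PhiM uv subrr.
have inB (t : R) : `|t| <= `|1| -> ball (Phi x) d (Phi u + t *: b).
  by rewrite normr1; exact: ball_segment.
pose fj (y : 'rV[R]_n) : R := F (G y) 0 j.
have der (p : 'rV[R]_n) : ball (Phi x) d p -> is_derive p b fj 0.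
  move=> /H[PGp dG rk dF [dP uP]].
  have dFG : differentiable (F \o G) p by exact: differentiable_comp.
  have lin : linear (fun B : 'rV[R]_m => B 0 j) by move=> a B C; rewrite !mxE.
  have [C CE] := linear_fun_ex lin.
  have cC : continuous C by apply: findim_linear_continuous; exact: findim_mx.
  have := is_derive_comp_linear cC (@diff_derivable _ _ _ (F \o G) p b dFG).
  rewrite CE (deriveE _ dFG) (diff_comp dG dF)/= (diff_jac _ dG) (diff_jac _ dF).
  suff -> : b *m jac G p *m jac F (G p) = 0 by rewrite mxE.
  (* It suffices to kill the product with [L]: there [jPhi] replaces [jac F *m L] by [jac Phi *m M],
     and [jac G *m jac Phi] is the identity, which leaves [b *m M]. *)
  apply: (mulmx_rank_eq0 (L := L)).
    have fP : row_full (jac Phi (G p)) by rewrite row_full_unit.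
    rewrite -(jPhi _ dF dP) rk (eqmxMfull M fP).
    by apply/eqP; exact: Mfull.
  have -> : b *m jac G p *m jac F (G p) *m L =
      b *m (jac G p *m jac Phi (G p)) *m M.
    by rewrite -!mulmxA (jPhi _ dF dP).
  rewrite -(jac_comp dG dP).
  suff -> : jac (fun y => Phi (G y)) p = 1%:M by rewrite mulmx1 bM.
  apply/matrixP => i k; rewrite mxE.
  by rewrite (near_eq_derive _ PGp) derive_id !mxE eqxx/= eq_sym.
have [|t t1 E] := @MVT_dir R _ fj (Phi u) b 1.
  by move=> t /inB/der[].
have [_ E0] := der _ (inB _ t1).
move: E; rewrite E0 mulr0 scale1r /b subrKC => /eqP; rewrite subr_eq0.
by move=> /eqP/esym.
Unshelve. all: by end_near. Qed.

End SubmersionsAndConstantRank.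

(** * Smooth maps between manifolds *)

Section SmoothPoints.
Context {R : realType}.
Implicit Types U V W : normedModType R.
Implicit Types M N : topologicalType.

Lemma nbhs_setX M N (a : M) (b : N) (P : set M) (Q : set N) :
  nbhs a P -> nbhs b Q -> nbhs (a, b) (P `*` Q).
Proof. by move=> aP bQ; exists (P, Q). Qed.

Lemma open_setX M N (P : set M) (Q : set N) : open P -> open Q -> open (P `*` Q).
Proof.
move=> oP oQ; rewrite openE => -[a b] [/= Pa Qb].
by apply: nbhs_setX; apply: open_nbhs_nbhs.
Qed.

Lemma open_within_cont M N (D : set M) (f : M -> N) : open D ->
  {within D, continuous f} <-> forall a, D a -> {for a, continuous f}.
Proof.
move=> oD; rewrite continuous_open_subspace//.
by split=> cf a Da; apply: cf; [rewrite inE|rewrite inE in Da].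
Qed.

Section ChartFacts.
Context {V : normedModType R} {M : topologicalType} (c : chart V M).
Hypothesis cP : is_chart c.
Implicit Type a : M.

Lemma chart_dom_nbhs a : dom c a -> nbhs a (dom c).
Proof. by case: cP => oc *; exact: open_nbhs_nbhs. Qed.

Lemma chartK a : dom c a -> bwd c (fwd c a) = a.
Proof. by case: cP => _ _ cK _ _ ca; apply: cK; rewrite inE. Qed.

Lemma chart_fwd_cont a : dom c a -> {for a, continuous (fwd c)}.
Proof. by case: cP => oc _ _ /(open_within_cont _ oc) cf _; exact: cf. Qed.

Lemma chart_bwd_cont w : img c w -> {for w, continuous (bwd c)}.
Proof. by case: cP => _ oi _ _ /(open_within_cont _ oi) cf; exact: cf. Qed.

Lemma chart_fwdK w : img c w -> fwd c (bwd c w) = w.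
Proof. by move=> [a ca <-]; rewrite chartK. Qed.

Lemma chart_bwd_dom w : img c w -> dom c (bwd c w).
Proof. by move=> [a ca <-]; rewrite chartK. Qed.

Lemma chart_img_nbhs w : img c w -> nbhs w (img c).
Proof. by case: cP => _ oi *; exact: open_nbhs_nbhs. Qed.

Lemma near_chart a (P : M -> Prop) : dom c a -> (\forall b \near a, P b) ->
  \forall w \near fwd c a, P (bwd c w).
Proof.
move=> ca; have ica : img c (fwd c a) by exists a.
have := chart_bwd_cont ica; rewrite /prop_for /continuous_at (chartK ca); exact.
Qed.

Lemma near_img a : dom c a -> \forall w \near fwd c a, img c w.
Proof. by move=> ca; apply: chart_img_nbhs; exists a. Qed.

Lemma open_chart_image (P : set M) : open P -> P `<=` dom c -> open (fwd c @` P).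
Proof.
move=> oP Pc; rewrite openE => _ [a Pa <-].
have ca := Pc _ Pa; have nP : nbhs a P by exact: open_nbhs_nbhs.
apply: filterS (filterI (near_chart ca nP) (near_img ca)) => w [Pw iw].
by exists (bwd c w) => //; rewrite chart_fwdK.
Qed.

End ChartFacts.

(** Continuity is required separately: without it [f] could leave [dom d] arbitrarily close to [a],
    and the local representative would involve meaningless values of [fwd d]. *)
Definition smooth_point {V W : normedModType R} {M N : topologicalType}
    (A : set (chart V M)) (B : set (chart W N)) (f : M -> N) (a : M) : Prop :=
  {for a, continuous f} /\
  forall c d, A c -> B d -> dom c a -> dom d (f a) ->
    smooth_at (local_repr c d f) (fwd c a).

(* What is used of a smooth manifold; smoothness of the transition maps is
   smoothness of the identity. *)
Definition smooth_atlas {V : normedModType R} {M : topologicalType}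
    (A : set (chart V M)) : Prop :=
  [/\ findim V, forall c, A c -> is_chart c,
      forall a, exists2 c, A c & dom c a &
      forall a, smooth_point A A id a].

Section Charted.
Context {V W : normedModType R} {M N : topologicalType}.
Context {A : set (chart V M)} {B : set (chart W N)}.
Hypotheses (Aat : smooth_atlas A) (Bat : smooth_atlas B).

Lemma near_local_repr c d f a : A c -> B d -> dom c a -> dom d (f a) ->
  {for a, continuous f} ->
  \forall w \near fwd c a, [/\ img c w, dom c (bwd c w) & dom d (f (bwd c w))].
Proof.
case: Aat => _ Ac _ _; case: Bat => _ Bc _ _ Acc Bd ca dfa cf.
have n1 := near_img (Ac _ Acc) ca.
have n2 := near_chart (Ac _ Acc) ca (cf _ (chart_dom_nbhs (Bc _ Bd) dfa)).
apply: filterS (filterI n1 n2) => w [iw dw]; split=> //.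
exact: (chart_bwd_dom (Ac _ Acc)).
Qed.

Lemma smoothP f : smooth A B f <-> forall a, smooth_point A B f a.
Proof.
have [fV Ac Acov _] := Aat; have [fW Bc Bcov _] := Bat.
split=> [[cf sf] a|sf]; last first.
  split=> [a|c d Acc Bd]; first exact: (sf a).1.
  apply: smooth_at_on => _ [a [ca /= da] <-]; exact: (sf a).2.
split=> [|c d Acc Bd ca da]; first exact: cf.
apply: (smooth_on_at fV fW _ (sf c d Acc Bd)); last by exists a.
have [oc _ _ _ _] := Ac _ Acc; have [od _ _ _ _] := Bc _ Bd.
apply: (open_chart_image (Ac _ Acc)); last by move=> ? [].
by apply: openI => //; move/continuousP: cf; apply.
Qed.

Lemma near_eq_smooth_point f g a : (\forall b \near a, f b = g b) ->
  smooth_point A B f a -> smooth_point A B g a.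
Proof.
have [fV Ac Acov _] := Aat.
move=> fg [cf sf]; have fga := nbhs_singleton fg.
split=> [|c d Acc Bd ca]; first exact: near_eq_cont fg cf.
rewrite -fga => da; apply: near_eq_smooth (sf _ _ Acc Bd ca da).
have := near_chart (Ac _ Acc) ca fg.
by apply: filterS => w E; rewrite /local_repr /= E.
Qed.

(** Smoothness of a germ makes the local representative differentiable near [fwd c a]; read through
    the charts this gives continuity around [a], as [smooth_lift] demands. *)
Lemma smooth_point_near_cont f a : smooth_point A B f a ->
  \forall b \near a, {for b, continuous f}.
Proof.
have [fV Ac Acov _] := Aat; have [fW Bc Bcov _] := Bat.
move=> [cf sf]; have [c Acc ca] := Acov a; have [d Bd da] := Bcov (f a).
have scd := sf _ _ Acc Bd ca da.
have n1 : \forall w \near fwd c a, {for w, continuous (local_repr c d f)}.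
  have := smooth_at_near_diff scd; apply: filterS => w; exact: differentiable_continuous.
have n2 := near_join (chart_dom_nbhs (Ac _ Acc) ca).
have n3 := near_join (cf _ (chart_dom_nbhs (Bc _ Bd) da)).
have n4 := chart_fwd_cont (Ac _ Acc) ca n1.
apply: filterS (filterI n2 (filterI n3 n4)) => b [nb2 [nb3 /= nb4]].
have cb := nbhs_singleton nb2; have db := nbhs_singleton nb3; rewrite /= in db.
apply: (@near_eq_cont _ _ (bwd d \o local_repr c d f \o fwd c)).
  apply: filterS (filterI nb2 nb3) => b' [cb' db'].
  by rewrite /local_repr /= (chartK (Ac _ Acc))// (chartK (Bc _ Bd)).
apply: continuous_comp; first exact: (chart_fwd_cont (Ac _ Acc)).
apply: continuous_comp => //.
rewrite /local_repr /= (chartK (Ac _ Acc))//.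
by apply: (chart_bwd_cont (Bc _ Bd)); exists (f b).
Qed.

Lemma smooth_point_fwd c a : A c -> dom c a ->
  smooth_point A (vect_atlas V) (fwd c) a.
Proof.
have [fV Ac Acov Aid] := Aat.
move=> Acc ca; split=> [|c' _ Ac' /= -> c'a _]; first exact: (chart_fwd_cont (Ac _ Acc)).
exact: ((Aid a).2 c' c).
Qed.

Lemma smooth_point_bwd c w : A c -> img c w ->
  smooth_point (vect_atlas V) A (bwd c) w.
Proof.
have [fV Ac Acov Aid] := Aat.
move=> Acc cw; split=> [|_ c' /= -> Ac' _ c'a]; first exact: (chart_bwd_cont (Ac _ Acc)).
have := (Aid (bwd c w)).2 c c' Acc Ac' (chart_bwd_dom (Ac _ Acc) cw) c'a.
by rewrite (chart_fwdK (Ac _ Acc)).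
Qed.

End Charted.

Lemma smooth_atlas_vect V : findim V -> smooth_atlas (vect_atlas V).
Proof.
move=> fV; split=> // [c /= ->|a|a].
- split=> /=.
  + exact: openT.
  + by rewrite /img/= image_id; exact: openT.
  + by [].
  + by apply/(open_within_cont _ openT) => a _; exact: cvg_id.
  + by rewrite /img/= image_id; apply/(open_within_cont _ openT) => a _; exact: cvg_id.
- by exists (Chart setT id id).
- split=> [|c d /= -> -> _ _]; first exact: cvg_id.
  by move=> k; exact: Ck_id.
Qed.

Lemma smooth_manifold_atlas V M (A : set (chart V M)) : findim V ->
  smooth_manifold A -> smooth_atlas A.
Proof.
move=> fV [_ _ Ac Acov At]; split=> // a; split=> [|c d Acc Ad /= ca da]; first exact: cvg_id.
apply: (smooth_on_at fV fV _ (At c d Acc Ad)); last by exists a.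
have [oc _ _ _ _] := Ac _ Acc; have [od _ _ _ _] := Ac _ Ad.
apply: (open_chart_image (Ac _ Acc)); first exact: openI.
by move=> ? [].
Qed.

Lemma smooth_vect V W (f : V -> W) a : smooth_at f a ->
  smooth_point (vect_atlas V) (vect_atlas W) f a.
Proof.
by move=> sf; split=> [|c d /= -> -> _ _ //]; exact: smooth_at_cont.
Qed.

Lemma smooth_vect2 U V W (f : V * W -> U) p : smooth_at f p ->
  smooth_point (prod_atlas (vect_atlas V) (vect_atlas W)) (vect_atlas U) f p.
Proof.
move=> sf; split=> [|_ _ [c [d [/= -> -> ->]]] /= -> _ _].
  exact: smooth_at_cont.
rewrite -surjective_pairing (_ : local_repr _ _ f = f) //.
by apply/funext => -[].
Qed.

Lemma smooth_point_comp U V W M N (P : topologicalType) (A : set (chart U M))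
    (B : set (chart V N)) (C : set (chart W P)) (f : M -> N) (g : N -> P) a :
  smooth_atlas A -> smooth_atlas B -> smooth_atlas C ->
  smooth_point A B f a -> smooth_point B C g (f a) ->
  smooth_point A C (fun x => g (f x)) a.
Proof.
move=> Aat Bat Cat [cf sf] [cg sg].
have [fU Ac _ _] := Aat; have [fV Bc Bcov _] := Bat; have [fW Cc _ _] := Cat.
split=> [|c e Acc Ce ca ega]; first exact: continuous_comp.
have [d Bd da] := Bcov (f a).
have n1 := near_local_repr Aat Bat Acc Bd ca da cf.
have E := chartK (Ac _ Acc) ca.
apply: (@near_eq_smooth _ _ _ (fun w => local_repr d e g (local_repr c d f w))).
  by apply: filterS n1 => w [_ _ dw]; rewrite /local_repr /= (chartK (Bc _ Bd)).
apply: smooth_at_comp => //; first exact: sf.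
by rewrite /local_repr /= E; exact: sg.
Qed.

Lemma smooth_point_pair U V W M N (P : topologicalType) (A : set (chart U M))
    (B : set (chart V N)) (C : set (chart W P)) (f : M -> N) (g : M -> P) a :
  smooth_point A B f a -> smooth_point A C g a ->
  smooth_point A (prod_atlas B C) (fun x => (f x, g x)) a.
Proof.
move=> [cf sf] [cg sg]; split=> [|c _ Acc [d [e [Bd Ce ->]]] ca [/= dfa ega]].
  exact: cvg_pair.
by move=> k; apply: Ck_pair; [exact: sf|exact: sg].
Qed.

Section Products.
Context {V W : normedModType R} {M N : topologicalType}.
Context {A : set (chart V M)} {B : set (chart W N)}.
Hypotheses (Aat : smooth_atlas A) (Bat : smooth_atlas B).

Lemma smooth_point_fst p : smooth_point (prod_atlas A B) A fst p.
Proof.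
have [fV Ac _ Aid] := Aat; have [fW Bc _ _] := Bat.
split=> [|_ c' [c [d [Acc Bd ->]]] Ac' [/= c1 d2] c'1]; first exact: cvg_fst.
apply: (@smooth_at_comp _ _ _ _ fst (local_repr c c' id)) => //.
  by move=> k; apply: Ck_linear => x; exact: cvg_fst.
exact: (Aid _).2.
Qed.

Lemma smooth_point_snd p : smooth_point (prod_atlas A B) B snd p.
Proof.
have [fV Ac _ _] := Aat; have [fW Bc _ Bid] := Bat.
split=> [|_ d' [c [d [Acc Bd ->]]] Bd' [/= c1 d2] d'1]; first exact: cvg_snd.
apply: (@smooth_at_comp _ _ _ _ snd (local_repr d d' id)) => //.
  by move=> k; apply: Ck_linear => x; exact: cvg_snd.
exact: (Bid _).2.
Qed.

Lemma img_prod_chart (c : chart V M) (d : chart W N) :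
  img (prod_chart c d) = img c `*` img d.
Proof.
apply/seteqP; split=> [_ [[a b] [/= ca db] <-]|[v w] /= [[a ca <-] [b db <-]]].
  by split; [exists a|exists b].
by exists (a, b).
Qed.

Lemma smooth_atlas_prod : smooth_atlas (prod_atlas A B).
Proof.
have [fV Ac Acov Aid] := Aat; have [fW Bc Bcov Bid] := Bat.
split.
- exact: findim_prod.
- move=> _ [c [d [Acc Bd ->]]].
  have cc := Ac _ Acc; have cd := Bc _ Bd.
  have [oc oic _ _ _] := cc; have [od oid _ _ _] := cd.
  have odom : open (dom c `*` dom d) by exact: open_setX.
  have oimg : open (img c `*` img d) by exact: open_setX.
  split; rewrite ?img_prod_chart//=.
  + by move=> [a b]; rewrite inE/= => -[/= ca db]; rewrite !chartK.
  + apply/(open_within_cont _ odom) => -[a b] [/= ca db].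
    by apply: cvg_pair; apply: continuous_comp => //=;
      [exact: cvg_fst|exact: chart_fwd_cont|exact: cvg_snd|exact: chart_fwd_cont].
  + apply/(open_within_cont _ oimg) => -[a b] [/= ca db].
    by apply: cvg_pair; apply: continuous_comp => //=;
      [exact: cvg_fst|exact: chart_bwd_cont|exact: cvg_snd|exact: chart_bwd_cont].
- move=> [a b]; have [c Acc ca] := Acov a; have [d Bd db] := Bcov b.
  by exists (prod_chart c d) => //; exists c, d.
- move=> p; rewrite (_ : id = fun p : M * N => (p.1, p.2)); last first.
    by apply/funext => -[].
  by apply: smooth_point_pair; [exact: smooth_point_fst|exact: smooth_point_snd].
Qed.

End Products.

End SmoothPoints.

(** * Maps into submanifolds and local sections *)

Section Submanifolds.
Context {R : realType}.
Implicit Types U V W : normedModType R.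
Implicit Types M N : topologicalType.

(** This is where embeddedness enters: it holds for the subspace topology and would fail for a finer
    one. *)
Lemma cvg_set_val M N (S : set M) (f : N -> S) a :
  {for a, continuous (fun x => set_val (f x))} -> {for a, continuous f}.
Proof.
move=> cf P /= [_ [[Q oQ <-] Qfa QP]].
have nQ : nbhs (set_val (f a)) Q by exact: open_nbhs_nbhs.
have H : nbhs a [set x | Q (set_val (f x))] by exact: (cf Q nQ).
exact: (filterS (fun x (Qx : Q (set_val (f x))) => QP (f x) Qx) H).
Qed.

(** In charts the inclusion is a map with injective differential, so [smooth_lift] applies once the
    subspace topology has given continuity of [f] near [a]. *)
Lemma smooth_point_lift V W M N (A : set (chart V M)) (S : set M) (k : nat)
    (B : set (chart 'rV[R]_k S)) (C : set (chart W N)) (f : N -> S) a :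
  smooth_atlas A -> smooth_atlas C -> submanifold A B ->
  smooth_point C A (fun x => set_val (f x)) a -> smooth_point C B f a.
Proof.
move=> Aat Cat [Bm [si inj]] sf.
have Bat := smooth_manifold_atlas (findim_mx _ _) Bm.
have si' := (smoothP Bat Aat _).1 si.
have [fV Ac Acov _] := Aat; have [fk Bc _ _] := Bat; have [fW Cc _ _] := Cat.
have cf := cvg_set_val sf.1.
have ncf : \forall b \near a, {for b, continuous f}.
  by have := smooth_point_near_cont Cat Aat sf; apply: filterS => b /cvg_set_val.
split=> // c d Acc Bd ca da.
have [e Ae ea] := Acov (set_val (f a)).
have E := chartK (Cc _ Acc) ca.
have n1 := near_local_repr Cat Bat Acc Bd ca da cf.
have n2 := near_chart (Cc _ Acc) ca ncf.
apply: (@smooth_lift _ _ _ _ (local_repr c d f) (local_repr d e set_val)) => //.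
- by rewrite /local_repr /= E; exact: inj.
- by rewrite /local_repr /= E; exact: (si' (f a)).2.
- apply: filterS (filterI n1 n2) => w [[iw cw dw] cfw].
  apply: continuous_comp; first exact: (chart_bwd_cont (Cc _ Acc)).
  by apply: continuous_comp => //; exact: (chart_fwd_cont (Bc _ Bd)).
- apply: near_eq_smooth (sf.2 c e Acc Ae ca ea).
  by apply: filterS n1 => w [_ _ dw]; rewrite /local_repr /= (chartK (Bc _ Bd)).
Qed.

(** One pair of charts suffices: the section of the local representative is carried back by [bwd c],
    and continuity keeps its composite with [f] inside [dom d] near [f a]. *)
Lemma local_section k l M N (A : set (chart 'rV[R]_k M)) (B : set (chart 'rV[R]_l N))
    (f : M -> N) a c d :
  smooth_atlas A -> smooth_atlas B -> A c -> B d -> dom c a -> dom d (f a) ->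
  smooth_point A B f a ->
  (forall w, exists v, 'd (local_repr c d f) (fwd c a) v = w) ->
  exists s : N -> M, [/\ s (f a) = a, smooth_point B A s (f a) &
    \forall y \near f a, f (s y) = y].
Proof.
move=> Aat Bat Acc Bd ca da sf surj.
have [fk Ac _ _] := Aat; have [fl Bc _ _] := Bat.
have E := chartK (Ac _ Acc) ca.
have [s [sa ss Ps]] := submersion_section (sf.2 c d Acc Bd ca da) surj.
have Pa : local_repr c d f (fwd c a) = fwd d (f a) by rewrite /local_repr /= E.
rewrite Pa in sa ss Ps.
have sg : smooth_point B (vect_atlas 'rV[R]_k) (fun y => s (fwd d y)) (f a).
  apply: (smooth_point_comp Bat (smooth_atlas_vect fl) (smooth_atlas_vect fk)).
    exact: smooth_point_fwd.
  exact: smooth_vect.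
have ssec : smooth_point B A (fun y => bwd c (s (fwd d y))) (f a).
  apply: (smooth_point_comp Bat (smooth_atlas_vect fk) Aat sg).
  by apply: smooth_point_bwd => //; rewrite sa; exists a.
exists (fun y => bwd c (s (fwd d y))); split => //; first by rewrite sa.
have cs := smooth_at_cont ss.
have cfw := chart_fwd_cont (Bc _ Bd) da.
have n1 := chart_dom_nbhs (Bc _ Bd) da.
have n2 : \forall y \near f a, local_repr c d f (s (fwd d y)) = fwd d y.
  exact: (cfw _ Ps).
have n3 : \forall y \near f a, dom d (f (bwd c (s (fwd d y)))).
  apply: (ssec.1 (f @^-1` dom d)); rewrite /= sa E.
  exact: (sf.1 _ (chart_dom_nbhs (Bc _ Bd) da)).
apply: filterS (filterI n1 (filterI n2 n3)) => y [dy [Py dfy]].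
have := congr1 (bwd d) Py; rewrite /local_repr /= (chartK (Bc _ Bd) dy).
by rewrite (chartK (Bc _ Bd) dfy).
Qed.

End Submanifolds.

(** * The adjoint and coadjoint actions *)

Section LieGroup.
Context {R : realType} {n : nat} {G : groupTopologicalType}.
Variables (A : set (chart 'rV[R]_n G)) (c : chart 'rV[R]_n G).
Hypotheses (LA : lie_group A) (Acc : A c) (c1 : dom c 1%g).
Implicit Types (x y g : G) (Y Z : 'rV[R]_n) (mu xi eta : 'cV[R]_n).

Let frV : findim 'rV[R]_n. Proof. exact: findim_mx. Qed.

Lemma lie_atlas : smooth_atlas A.
Proof. by case: LA => mA _ _; exact: smooth_manifold_atlas. Qed.

Let Aat := lie_atlas.
Let AAat := smooth_atlas_prod Aat Aat.
Let Ac : is_chart c. Proof. by have [_ H _ _] := Aat; exact: H. Qed.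

Lemma smooth_mul p : smooth_point (prod_atlas A A) A (fun p : G * G => (p.1 * p.2)%g) p.
Proof. by case: LA => _ sm _; exact: (smoothP AAat Aat _).1. Qed.

Lemma smooth_inv x : smooth_point A A (fun x : G => (x^-1)%g) x.
Proof. by case: LA => _ _ si; exact: (smoothP Aat Aat _).1. Qed.

Lemma smooth_conj p :
  smooth_point (prod_atlas A A) A (fun p : G * G => (p.1 * p.2 * p.1^-1)%g) p.
Proof.
have s1 : smooth_point (prod_atlas A A) A (fun p : G * G => (p.1^-1)%g) p.
  have sf := smooth_point_fst Aat Aat p.
  exact: (smooth_point_comp AAat Aat Aat sf (smooth_inv _)).
have sp := smooth_point_pair (smooth_mul p) s1.
exact: (smooth_point_comp AAat AAat Aat sp (smooth_mul _)).
Qed.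

Lemma smooth_point_cst (M N : topologicalType) (V W : normedModType R)
    (B : set (chart V M)) (C : set (chart W N)) (b : N) (a : M) :
  smooth_point B C (fun=> b) a.
Proof.
split=> [|d e Bd Ce da eb]; first exact: cvg_cst.
by move=> k; exact: Ck_cst.
Qed.

Lemma smooth_conjg x y : smooth_point A A (fun y => (x * y * x^-1)%g) y.
Proof.
have [_ _ _ Aid] := Aat.
have sp := smooth_point_pair (smooth_point_cst A A x y) (Aid y).
exact: (smooth_point_comp Aat AAat Aat sp (smooth_conj _)).
Qed.

Lemma smooth_mulr x y : smooth_point A A (fun y => (y * x)%g) y.
Proof.
have [_ _ _ Aid] := Aat.
have sp := smooth_point_pair (Aid y) (smooth_point_cst A A x y).
exact: (smooth_point_comp Aat AAat Aat sp (smooth_mul _)).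
Qed.

(** The partial differential is the directional derivative of [F] along [(0, d)], restricted to a
    slice. Both [Ad] and [left_invariant] are such differentials of smooth maps of two variables,
    taken at the unit. *)
Lemma smooth_partial (U V W : normedModType R) (F : U * V -> W) (w : U) (u d : V) :
  findim U -> findim V -> findim W -> smooth_at F (w, u) ->
  smooth_at (fun w => 'd (fun u => F (w, u)) u d) w.
Proof.
move=> fU fV fW sF.
have ci : {for w, continuous (fun w : U => (w, u))}.
  by apply: cvg_pair; [exact: cvg_id|exact: cvg_cst].
have sD : smooth_at (fun v : U => 'D_(0, d) F (v, u)) w.
  apply: (@smooth_at_comp _ _ _ _ (fun v => (v, u)) ('D_(0, d) F)) => //.
  - exact: findim_prod.
  - by move=> k; apply: Ck_pair; [exact: Ck_id|exact: Ck_cst].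
  - exact: ((smooth_atP _ _).1 sF).2.
apply: near_eq_smooth sD.
have nF : \forall v \near w, differentiable F (v, u).
  exact: (ci _ (smooth_at_near_diff sF)).
apply: filterS nF => v dF.
have di : is_diff u (fun z : V => (v, z)) (fun z => (0, z)).
  exact: is_diff_pair.
have dii := @ex_diff _ _ _ _ _ _ _ di.
rewrite (deriveE _ dF).
have := congr1 (@^~ d) (@diff_comp _ _ _ _ (fun z : V => (v, z)) F u dii dF).
by rewrite /= (@diff_val _ _ _ _ _ _ _ di) => <-.
Qed.

Let u0 := fwd c 1%g.
Let u0K : bwd c u0 = 1%g. Proof. exact: (chartK Ac c1). Qed.

Lemma Ad_lin1 x Y : Y *m lin1_mx (Ad c x) = Ad c x Y.
Proof. by rewrite /Ad mul_rV_lin1. Qed.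

Lemma smooth_Ad e x Y : A e -> dom e x ->
  smooth_at (fun w => Ad c (bwd e w) Y) (fwd e x).
Proof.
move=> Ae ex.
pose F := local_repr (prod_chart e c) c (fun p : G * G => (p.1 * p.2 * p.1^-1)%g).
have sF : smooth_at F (fwd e x, u0).
  apply: ((smooth_conj (x, 1%g)).2 (prod_chart e c) c) => //=.
    by exists e, c.
  by rewrite mulg1 mulgV.
exact: (@smooth_partial _ _ _ F _ u0 Y).
Qed.

Lemma smooth_Ad_star eta x :
  smooth_point A (vect_atlas 'cV[R]_n) (fun x => Ad_star c x eta) x.
Proof.
have [_ AAc Acov _] := Aat.
have key e : A e -> dom e x -> smooth_at (fun w => Ad_star c (bwd e w) eta) (fwd e x).
  move=> Ae ex k; apply: Ck_mulmx; last exact: Ck_cst.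
  apply: Ck_mx => i j.
  rewrite (_ : (fun z => _) = fun w => Ad c (bwd e w) (delta_mx 0 i) 0 j); last first.
    by apply/funext => w; rewrite mxE.
  by apply: Ck_coord; exact: smooth_Ad.
split; last by move=> e d Ae /= -> ex _; exact: key.
have [e Ae ex] := Acov x; have ec := AAc _ Ae.
have H := smooth_at_cont (key e Ae ex).
apply: (@near_eq_cont _ _ ((fun w => Ad_star c (bwd e w) eta) \o fwd e)).
  by apply: filterS (chart_dom_nbhs ec ex) => y ey /=; rewrite (chartK ec).
by apply: continuous_comp => //; exact: chart_fwd_cont.
Qed.

Let conj x u := fwd c (x * bwd c u * x^-1)%g.

Lemma smooth_chart_conj x : smooth_at (conj x) u0.
Proof.
have := (smooth_conjg x 1%g).2 c c Acc Acc c1; apply.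
by rewrite mulg1 mulgV.
Qed.

Let conjxu0 x : conj x u0 = u0.
Proof. by rewrite /conj u0K mulg1 mulgV. Qed.

Lemma Ad1 Y : Ad c 1%g Y = Y.
Proof.
have nid : \forall u \near u0, id u = conj 1%g u.
  apply: filterS (near_img Ac c1) => u iu.
  by rewrite /conj mul1g invg1 mulg1 (chart_fwdK Ac).
have did : differentiable (id : 'rV[R]_n -> 'rV[R]_n) u0 by exact: ex_diff.
have [_ E] := near_eq_diff nid did.
apply: (etrans (congr1 (@^~ Y) E)).
by rewrite (diff_val (f := id)).
Qed.

(** Conjugations fix the unit, so this is the chain rule at [u0]. The local representatives compose
    only near [u0], while [y * bwd c u * y^-1] remains in [dom c]. *)
Lemma AdM x y Y : Ad c (x * y)%g Y = Ad c x (Ad c y Y).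
Proof.
have sx := smooth_at_diff (smooth_chart_conj x).
have sy := smooth_at_diff (smooth_chart_conj y).
have nE : \forall u \near u0, (conj x \o conj y) u = conj (x * y)%g u.
  have cy : {for 1%g, continuous (fun z : G => (y * z * y^-1)%g)} := (smooth_conjg y 1%g).1.
  have dy : \forall z \near (1%g : G), dom c (y * z * y^-1)%g.
    apply: (cy (dom c)); rewrite mulg1 mulgV; exact: chart_dom_nbhs.
  apply: filterS (near_chart Ac c1 dy) => u du.
  by rewrite /conj /= (chartK Ac)// invgM !mulgA.
have sx' : differentiable (conj x) (conj y u0) by rewrite conjxu0.
have dxy : differentiable (conj x \o conj y) u0 by exact: differentiable_comp.
have [_ E] := near_eq_diff nE dxy.
apply: (etrans (congr1 (@^~ Y) E)).
apply: (etrans (congr1 (@^~ Y) (diff_comp sy sx'))).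
by rewrite /= conjxu0.
Qed.

Lemma Ad_star1 xi : Ad_star c 1%g xi = xi.
Proof.
rewrite /Ad_star /covector_comp (_ : lin1_mx _ = 1%:M) ?mul1mx//.
by apply/row_matrixP => i; rewrite !rowE Ad_lin1 Ad1 mulmx1.
Qed.

(** Precomposition reverses the order, so this is a right action: the orbit map is equivariant under
    right translations and invariant under left translations by the isotropy group. *)
Lemma Ad_starM x y xi : Ad_star c (x * y)%g xi = Ad_star c y (Ad_star c x xi).
Proof.
have E : lin1_mx (Ad c (x * y)%g) = lin1_mx (Ad c y) *m lin1_mx (Ad c x).
  apply/row_matrixP => i; rewrite !rowE (mulmxA (delta_mx 0 i)).
  apply: (etrans (Ad_lin1 (x * y)%g _)); apply: (etrans (AdM x y _)); apply: esym.
  by apply: (etrans (congr1 (mulmx^~ _) (Ad_lin1 y _))); apply: (etrans (Ad_lin1 x _)).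
apply: (etrans (congr1 (mulmx^~ xi) E)); exact: (esym (mulmxA _ _ _)).
Qed.

Lemma Ad_starVK x xi : Ad_star c x (Ad_star c x^-1%g xi) = xi.
Proof. by rewrite -Ad_starM mulVg Ad_star1. Qed.

Lemma Ad_starK x xi : Ad_star c x^-1%g (Ad_star c x xi) = xi.
Proof. by rewrite -Ad_starM mulgV Ad_star1. Qed.

Lemma smooth_left_invariant Y : smooth_at (left_invariant c Y) u0.
Proof.
pose F := local_repr (prod_chart c c) c (fun p : G * G => (p.1 * p.2)%g).
have sF : smooth_at F (u0, u0).
  apply: ((smooth_mul (1%g, 1%g)).2 (prod_chart c c) c) => //=.
    by exists c, c.
  by rewrite mulg1.
exact: (@smooth_partial _ _ _ F _ u0 Y).
Qed.

Lemma left_invariant_linear u : linear (fun Y => left_invariant c Y u).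
Proof. by move=> a Y Z; rewrite /left_invariant linearP. Qed.

(** The rows of the matrix of [ad c Y] are its values at basis vectors [Z], so linearity in [Y] is
    what makes [ad_star] smooth. The bracket differentiates the field of [Y], whose smoothness
    enters here. *)
Lemma ad_linear Z : linear (fun Y => ad c Y Z).
Proof.
move=> a Y Y'.
have alg (p p' q q' : 'rV[R]_n) : (a *: p + p') - (a *: q + q') = a *: (p - q) + (p' - q').
  by rewrite scalerBr opprD addrACA.
have E : left_invariant c (a *: Y + Y') = a *: left_invariant c Y + left_invariant c Y'.
  by apply/funext => u; exact: left_invariant_linear.
have dY := smooth_at_diff (smooth_left_invariant Y).
have dY' := smooth_at_diff (smooth_left_invariant Y').
have daY : differentiable (a *: left_invariant c Y) u0 by exact: differentiableZ.
set v := left_invariant c Z u0.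
have H1 : 'd (left_invariant c Z) u0 (left_invariant c (a *: Y + Y') u0) =
    a *: 'd (left_invariant c Z) u0 (left_invariant c Y u0) +
    'd (left_invariant c Z) u0 (left_invariant c Y' u0).
  exact: (etrans (congr1 ('d (left_invariant c Z) u0) (left_invariant_linear u0 a Y Y'))
                 (linearP _ _ _ _)).
have H2 : 'd (left_invariant c (a *: Y + Y')) u0 v =
    a *: 'd (left_invariant c Y) u0 v + 'd (left_invariant c Y') u0 v.
  rewrite E; apply: (etrans (congr1 (@^~ v) (diffD daY dY'))).
  exact: (congr1 (fun w => w + 'd (left_invariant c Y') u0 v)
                 (congr1 (@^~ v) (diffZ a dY))).
exact: (etrans (congr2 (fun p q => p - q) H1 H2) (alg _ _ _ _)).
Qed.

Lemma smooth_ad_star (p : 'rV[R]_n * 'cV[R]_n) :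
  smooth_at (fun p : 'rV[R]_n * 'cV[R]_n => ad_star c p.1 p.2) p.
Proof.
move=> k; apply: Ck_mulmx; last by apply: Ck_linear => x; exact: cvg_snd.
apply: Ck_mx => i j.
have [L LE] := linear_fun_ex (ad_linear (delta_mx 0 i)).
rewrite (_ : (fun z => _) = fun p => L p.1 0 j); last first.
  by apply/funext => q; rewrite mxE LE.
apply: Ck_coord; apply: Ck_comp_linear; first exact: findim_linear_continuous.
by apply: Ck_linear => x; exact: cvg_fst.
Qed.

End LieGroup.

(** * The orbit map is a submersion *)

Section NowhereDense.
Context {T : topologicalType}.
Implicit Types C P : set T.

Definition closed_nowhere_dense C : Prop :=
  closed C /\ forall P, open P -> P `<=` C -> P = set0.

(** Removing the closed set [C] from an open subset of the union leaves an open subset of [C']. *)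
Lemma closed_nowhere_denseU C C' : closed_nowhere_dense C ->
  closed_nowhere_dense C' -> closed_nowhere_dense (C `|` C').
Proof.
move=> [cC C0] [cC' C'0]; split=> [|P oP PCC']; first exact: closedU.
have PC : P `\` C = set0.
  apply: C'0; first by rewrite setDE; apply: openI => //; exact: closed_openC.
  by move=> p [Pp nCp]; have [] := PCC' _ Pp.
by apply: C0 => // p Pp; apply: contrapT => nCp; have : set0 p by rewrite -PC.
Qed.

(* The closed nowhere dense sets are directed, so compactness yields a single one
   that contains the image of [f]. *)
Lemma compact_nowhere_dense (S : topologicalType) (f : S -> T) :
  compact [set: S] ->
  (forall x : S, exists2 K : set S, nbhs x K & closed_nowhere_dense (f @` K)) ->
  exists2 C, closed_nowhere_dense C & forall x, C (f x).
Proof.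
move=> /compact_near_coveringP cS fK.
(* A property of sets holds eventually for [F] when it holds for all supersets of some closed
   nowhere dense set. The covering form of compactness makes the local membership of [f x] in such a
   set uniform in [x]. *)
pose F := filter_from closed_nowhere_dense (fun C => [set C' | C `<=` C']).
have FF : Filter F.
  apply: filter_from_filter.
    exists set0; split=> [|P _ P0]; first exact: closed0.
    by apply/seteqP; split.
  move=> C C' nC nC'; exists (C `|` C'); first exact: closed_nowhere_denseU.
  by move=> D CC'D; split=> p Cp; apply: CC'D; [left|right].
have [|C nC CP] := cS (set T) F (fun C x => C (f x)) FF.
  move=> x _; have [K xK nK] := fK x.
  exists (K, [set C' | f @` K `<=` C']); first by split=> //=; exists (f @` K).
  by move=> [y C'] [/= Ky]; apply; exists y.
by exists C => // x; exact: (CP C).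
Qed.

End NowhereDense.

(** * Rank and local sections of the coadjoint orbit map *)

Section OrbitMap.
Context {R : realType} {n : nat} {G : groupTopologicalType}.
Context (A : set (chart 'rV[R]_n G)) (c : chart 'rV[R]_n G) (eta : 'cV[R]_n).
Context (m : nat) (AO : set (chart 'rV[R]_m (coadjoint_orbit c eta))).
Hypotheses (LA : lie_group A) (Acc : A c) (c1 : dom c 1%g).
Hypotheses (cptG : compact [set: G]) (sO : submanifold (vect_atlas 'cV[R]_n) AO).

Let Aat := lie_atlas LA.
Let Oat : smooth_atlas AO.
Proof. by case: sO => mO _; apply: smooth_manifold_atlas => //; exact: findim_mx. Qed.
Let Vat := smooth_atlas_vect (@findim_mx R n 1).
Let Rat := smooth_atlas_vect (@findim_mx R 1 n).

Definition orbit_map (x : G) : coadjoint_orbit c eta :=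
  exist (fun z => z \in coadjoint_orbit c eta) (Ad_star c x eta)
    (mem_set (ex_intro2 _ _ x I erefl)).

Lemma set_val_orbit_map x : set_val (orbit_map x) = Ad_star c x eta.
Proof. by rewrite set_valE. Qed.

Lemma set_val_inj (T : Type) (S : set T) : injective (set_val : S -> T).
Proof. by rewrite set_valE; exact: val_inj. Qed.

Lemma orbit_map_surj nu : exists x, orbit_map x = nu.
Proof.
have [x _ E] : coadjoint_orbit c eta (set_val nu).
  by apply: set_mem; rewrite set_valE; exact: valP.
by exists x; apply: set_val_inj; rewrite set_val_orbit_map.
Qed.

Lemma smooth_orbit_map x : smooth_point A AO orbit_map x.
Proof.
apply: (smooth_point_lift Vat Aat sO).
rewrite (_ : (fun x => _) = fun x => Ad_star c x eta).
  exact: (smooth_Ad_star LA Acc c1).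
by apply/funext => y; exact: set_val_orbit_map.
Qed.

(* The transposition turns covectors into row vectors, to which [jac] applies. *)
Let rowmap (x : G) : 'rV[R]_n := (Ad_star c x eta)^T.

Let smooth_trmx (z : 'cV[R]_n) : smooth_at (fun z : 'cV[R]_n => z^T) z.
Proof.
have [|L LE] := @linear_fun_ex R 'cV[R]_n 'rV[R]_n (fun z => z^T).
  by move=> a u v; rewrite linearP.
by move=> k; rewrite -LE; apply: Ck_linear; apply: findim_linear_continuous; exact: findim_mx.
Qed.

Let smooth_rowmap x : smooth_point A (vect_atlas 'rV[R]_n) rowmap x.
Proof.
exact: (smooth_point_comp Aat Vat Rat (smooth_Ad_star LA Acc c1 eta x)
         (smooth_vect (smooth_trmx _))).
Qed.

Let id_chart {V : normedModType R} : chart V V := Chart setT id id.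

(** The rank is taken in the ambient dual space, where right translation acts by a fixed invertible
    matrix; no chart of the orbit is involved. *)
Definition chart_rank (e : chart 'rV[R]_n G) x : nat :=
  \rank (jac (local_repr e id_chart rowmap) (fwd e x)).

(* [rowmap (y * g) = rowmap y *m K] for the invertible matrix [K] of [Ad*_g]. *)
Lemma chart_rank_le e e' x x' : A e -> A e' -> dom e x -> dom e' x' ->
  (chart_rank e x <= chart_rank e' x')%N.
Proof.
move=> Ae Ae' ex ex'; pose g := (x^-1 * x')%g.
have xg : (x * g)%g = x' by rewrite /g mulVKg.
have [_ AAc _ _] := Aat.
have eE := chartK (AAc _ Ae) ex.
pose K := (lin1_mx (Ad c g))^T.
have equiv y : rowmap (y * g)%g = rowmap y *m K.
  by rewrite /rowmap (Ad_starM LA Acc c1) /Ad_star /covector_comp trmx_mul.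
have uK : row_free K.
  apply/row_freeP; exists (lin1_mx (Ad c g^-1%g))^T.
  rewrite -trmx_mul -trmx1; congr (_^T).
  apply/row_matrixP => i; rewrite !rowE mulmx1.
  apply: (etrans (mulmxA _ _ _)).
  apply: (etrans (congr1 (mulmx^~ _) (Ad_lin1 c g^-1%g _))).
  apply: (etrans (Ad_lin1 c g _)); apply: (etrans (esym (AdM LA Acc c1 _ _ _))).
  by rewrite mulgV (Ad1 LA Acc c1).
pose F := local_repr e id_chart rowmap; pose F' := local_repr e' id_chart rowmap.
pose H := local_repr e e' (fun y => (y * g)%g).
have sH : smooth_at H (fwd e x).
  by apply: (smooth_mulr LA g x).2 => //; rewrite xg.
have Hx : H (fwd e x) = fwd e' x' by rewrite /H /local_repr /= eE xg.
have sF : smooth_at F (fwd e x) by exact: (smooth_rowmap x).2.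
have sF' : smooth_at F' (H (fwd e x)) by rewrite Hx; exact: (smooth_rowmap x').2.
(* The constant term 0 gives the right-hand side the affine form that [smooth_affine] and
   [diff_affine] treat. *)
have E : \forall w \near fwd e x, F' (H w) = 0 + F w *m K.
  have ex'g : dom e' (x * g)%g by rewrite xg.
  have := near_local_repr Aat Aat Ae Ae' ex ex'g (smooth_mulr LA g x).1.
  apply: filterS => w [_ _ dw].
  by rewrite /F' /H /local_repr /= (chartK (AAc _ Ae') dw) equiv add0r.
have dF := smooth_at_diff sF; have dF' := smooth_at_diff sF'.
have dH := smooth_at_diff sH.
have J1 := jac_comp dH dF'.
have dK : differentiable (fun v : 'rV[R]_n => 0 + v *m K) (F (fwd e x)).
  by apply: smooth_at_diff; exact: smooth_affine.
have J2 := jac_comp dF dK.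
have JK : jac (fun v : 'rV[R]_n => 0 + v *m K) (F (fwd e x)) = K.
  apply/row_matrixP => i; rewrite !rowE -(diff_jac _ dK); exact: diff_affine.
have J12 : jac (fun w => F' (H w)) (fwd e x) = jac (fun w => 0 + F w *m K) (fwd e x).
  exact: near_eq_jac.
rewrite /chart_rank -/F -/F' -Hx.
have JE := etrans (congr1 (mulmx (jac F (fwd e x))) (esym JK))
  (etrans (esym J2) (etrans (esym J12) J1)).
apply: (@leq_trans (\rank (jac F (fwd e x) *m K))).
  by rewrite (mxrankMfree _ uK).
rewrite JE; exact: mxrankM_maxr.
Qed.

(** The inclusion of the orbit is an immersion, and composing with an injective linear map preserves
    the rank. *)
Lemma rank_orbit_map e d x : A e -> AO d -> dom e x -> dom d (orbit_map x) ->
  \rank (jac (local_repr e d orbit_map) (fwd e x)) = chart_rank e x.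
Proof.
move=> Ae Od ex dx.
have [_ AAc _ _] := Aat; have [_ Oc _ _] := Oat.
have eE := chartK (AAc _ Ae) ex.
have [mO [si inj]] := sO.
pose F := local_repr e d orbit_map.
pose I := local_repr d id_chart (set_val : coadjoint_orbit c eta -> _).
have Fx : F (fwd e x) = fwd d (orbit_map x) by rewrite /F /local_repr /= eE.
have sF : smooth_at F (fwd e x) by exact: (smooth_orbit_map x).2.
have sI : smooth_at I (F (fwd e x)).
  by rewrite Fx; apply: ((smoothP Oat Vat _).1 si (orbit_map x)).2.
have injI : injective ('d I (F (fwd e x))) by rewrite Fx; exact: inj.
have dF := smooth_at_diff sF; have dI := smooth_at_diff sI.
have dT z : differentiable (fun z : 'cV[R]_n => z^T) z.
  by apply: smooth_at_diff; exact: smooth_trmx.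
have dIT : differentiable (fun v => (I v)^T) (F (fwd e x)).
  exact: (@differentiable_comp _ _ _ _ I (fun z : 'cV[R]_n => z^T)).
have E : \forall w \near fwd e x, (I (F w))^T = local_repr e id_chart rowmap w.
  have := near_local_repr Aat Oat Ae Od ex dx (smooth_orbit_map x).1.
  apply: filterS => w [_ _ dw].
  by rewrite /F /I /local_repr /= (chartK (Oc _ Od) dw) set_val_orbit_map.
have J := jac_comp dF dIT.
have J12 : jac (fun w => (I (F w))^T) (fwd e x) = jac (local_repr e id_chart rowmap) (fwd e x).
  exact: near_eq_jac.
have fr : row_free (jac (fun v => (I v)^T) (F (fwd e x))).
  apply: inj_row_free => v; rewrite -(diff_jac _ dIT).
  have -> : 'd (fun v => (I v)^T) (F (fwd e x)) v = ('d I (F (fwd e x)) v)^T.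
    have [|L LE] := @linear_fun_ex R 'cV[R]_n 'rV[R]_n (fun z => z^T).
      by move=> a u w; rewrite linearP.
    have cL : continuous L by apply: findim_linear_continuous; exact: findim_mx.
    have dL : differentiable L (I (F (fwd e x))) by exact: linear_differentiable.
    have E1 := congr1 (@^~ v) (diff_comp dI dL).
    have E2 := congr1 (@^~ ('d I (F (fwd e x)) v)) (diff_lin (I (F (fwd e x))) cL).
    have := etrans E1 E2; rewrite LE; exact.
  move/(congr1 trmx); rewrite trmxK trmx0 => E0.
  by apply: injI; rewrite E0 linear0.
by rewrite /chart_rank -J12 J mxrankMfree.
Qed.

(* If the rank [r] were less than [m], then near each point the coordinates of
   [orbit_map y] would be determined by [r] linear forms, so that [orbit_map]
   could not fill a neighbourhood. *)
Lemma orbit_map_rank e d x : A e -> AO d -> dom e x -> dom d (orbit_map x) ->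
  \rank (jac (local_repr e d orbit_map) (fwd e x)) = m.
Proof.
move=> Ae Od ex dx.
set r := \rank _.
have rE e' d' x' : A e' -> AO d' -> dom e' x' -> dom d' (orbit_map x') ->
    \rank (jac (local_repr e' d' orbit_map) (fwd e' x')) = r.
  move=> Ae' Od' ex' dx'; apply: (etrans (rank_orbit_map Ae' Od' ex' dx')).
  apply: (etrans _ (esym (rank_orbit_map Ae Od ex dx))).
  apply: anti_leq; apply/andP; split; first exact: (chart_rank_le Ae' Ae ex' ex).
  exact: (chart_rank_le Ae Ae' ex ex').
have [_ AAc Acov _] := Aat; have [_ Oc Ocov _] := Oat.
apply/eqP; rewrite eqn_leq rank_leq_col leqNgt; apply/negP => rm.
have [mG _ _] := LA; have [hG _ _ _ _] := mG; have [mO _] := sO.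
have [hO _ _ _ _] := mO.
have co : continuous orbit_map by move=> y; exact: (smooth_orbit_map y).1.
have [|C [cC C0] Co] := @compact_nowhere_dense _ G orbit_map cptG; last first.
  (* The orbit map is onto, so [C] would be the whole orbit, a nonempty open subset of itself. *)
  have CT : C = setT.
    by apply/seteqP; split=> // nu _; have [y <-] := orbit_map_surj nu.
  have : set0 (orbit_map x) by rewrite -(C0 setT)// ?CT//; exact: openT.
  by [].
move=> y; have [e' Ae' ey] := Acov y; have [d' Od' dy] := Ocov (orbit_map y).
pose F := local_repr e' d' orbit_map.
have sF : smooth_at F (fwd e' y) by exact: (smooth_orbit_map y).2.
have n1 := near_local_repr Aat Oat Ae' Od' ey dy (co y).
have nr : \forall w \near fwd e' y, \rank (jac F w) = r.
  apply: filterS n1 => w [iw ew dw].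
  by rewrite -[w in jac F w](chart_fwdK (AAc _ Ae') iw) rE.
have [L [N [nN LP]]] := constant_rank sF nr.
have nU : nbhs y (dom e' `&` orbit_map @^-1` dom d' `&` fwd e' @^-1` N).
  apply: filterI; first apply: filterI.
  - exact: (chart_dom_nbhs (AAc _ Ae') ey).
  - exact: (co y _ (chart_dom_nbhs (Oc _ Od') dy)).
  - exact: (chart_fwd_cont (AAc _ Ae') ey nN).
have [K yK KU] := compact_regular hG cptG filterT nU.
exists (closure K); first by apply: filterS yK; exact: subset_closure.
split.
  apply: compact_closed => //; apply: continuous_compact.
    exact: continuous_subspaceT.
  by apply: subclosed_compact cptG _ => //; exact: closed_closure.
move=> P oP PK; apply/seteqP; split=> // nu Pnu.
have Pd : P `<=` dom d' by move=> _ /PK[z /KU[[_ ?] _] <-].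
have FE z : closure K z -> F (fwd e' z) = fwd d' (orbit_map z).
  by move=> /KU[[ez _] _]; rewrite /F /local_repr /= (chartK (AAc _ Ae') ez).
have inj z z' : closure K z -> closure K z' ->
    fwd d' (orbit_map z) *m L = fwd d' (orbit_map z') *m L ->
    fwd d' (orbit_map z) = fwd d' (orbit_map z').
  move=> Kz Kz' zz'; have [_ Nz] := KU _ Kz; have [_ Nz'] := KU _ Kz'.
  have zL : F (fwd e' z) *m L = F (fwd e' z') *m L.
    by rewrite (FE z Kz) (FE z' Kz').
  exact: (etrans (esym (FE z Kz)) (etrans (LP _ _ Nz Nz' zL) (FE z' Kz'))).
(* Such a [v] exists because [r < m]. Moving the coordinates of [nu] slightly along [v] stays in [P]
   without changing the product with [L], contrary to [inj]. *)
have [v vL v0] : exists2 v : 'rV[R]_m, v *m L = 0 & v != 0.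
  have : kermx L != 0.
    by rewrite -mxrank_eq0 mxrank_ker subn_eq0 -ltnNge (leq_ltn_trans (rank_leq_col _)).
  by move=> /rowV0Pn[v /sub_kermxP vL v0]; exists v.
have nuP : nbhs nu P by exact: open_nbhs_nbhs.
have dnu := Pd _ Pnu.
have nW : \forall w \near fwd d' nu, P (bwd d' w) /\ img d' w.
  exact: (filterI (near_chart (Oc _ Od') dnu nuP) (near_img (Oc _ Od') dnu)).
have cl : {for 0, continuous (fun t : R => fwd d' nu + t *: v)}.
  rewrite /prop_for /continuous_at scale0r addr0.
  rewrite -[X in _ --> X]addr0 -(scale0r v).
  by apply: cvgD; [exact: cvg_cst|exact: scalel_continuous].
rewrite /prop_for /continuous_at scale0r addr0 in cl.
have : \forall t \near (0 : R), P (bwd d' (fwd d' nu + t *: v)) /\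
    img d' (fwd d' nu + t *: v).
  by apply: (cl [set w | P (bwd d' w) /\ img d' w]); exact: nW.
move=> /nbhs_ballP[eps eps0 H].
have [Pw iw] : P (bwd d' (fwd d' nu + (eps / 2) *: v)) /\ img d' (fwd d' nu + (eps / 2) *: v).
  apply: (H (eps / 2)); rewrite -ball_normE/= sub0r normrN gtr0_norm ?divr_gt0//.
  by rewrite ltr_pdivrMr// ltr_pMr// ltr1n.
have [z Kz zE] := PK _ Pnu; have [z' Kz' z'E] := PK _ Pw.
have E' : fwd d' (orbit_map z') = fwd d' nu + (eps / 2) *: v.
  by rewrite z'E (chart_fwdK (Oc _ Od') iw).
have := inj z z' Kz Kz'; rewrite zE E' mulmxDl -scalemxAl vL scaler0 addr0.
move=> /(_ erefl)/eqP; rewrite eq_sym addrC -subr_eq0 addrK scaler_eq0 (negbTE v0) orbF.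
by rewrite gt_eqF// divr_gt0.
Qed.

Lemma orbit_section nu x : orbit_map x = nu ->
  exists s : coadjoint_orbit c eta -> G,
    [/\ s nu = x, smooth_point AO A s nu & \forall y \near nu, orbit_map (s y) = y].
Proof.
move=> <-.
have [_ _ Acov _] := Aat; have [_ _ Ocov _] := Oat.
have [e Ae ex] := Acov x; have [d Od dx] := Ocov (orbit_map x).
apply: (local_section Aat Oat Ae Od ex dx (smooth_orbit_map x)).
have dF := smooth_at_diff ((smooth_orbit_map x).2 e d Ae Od ex dx).
have /row_fullP[B BJ] : row_full (jac (local_repr e d orbit_map) (fwd e x)).
  by apply/eqP; exact: orbit_map_rank.
by move=> w; exists (w *m B); rewrite (diff_jac _ dF) -mulmxA BJ mulmx1.
Qed.

End OrbitMap.

(** * The reduced space *)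

Section Reduction.
Context {R : realType} {n : nat} {G : groupTopologicalType}.
Context (A : set (chart 'rV[R]_n G)) (c : chart 'rV[R]_n G) (eta : 'cV[R]_n).
Hypotheses (LA : lie_group A) (Acc : A c) (c1 : dom c 1%g).

Local Notation O := (coadjoint_orbit c eta : Type).
Local Notation J := (momentum_level c eta : Type).

(** Solving for [mu] exhibits the level set as a graph over [G * g * g^*], which [level_point]
    parametrizes. *)
Lemma momentum_levelP x Y mu xi : momentum_level c eta (x, Y, mu, xi) <->
  mu = Ad_star c x eta + ad_star c Y xi.
Proof.
rewrite /momentum_level /=; split=> [<-|->].
  by rewrite (Ad_starVK LA Acc c1) subrK.
by rewrite addrK (Ad_starK LA Acc c1).
Qed.

Definition level_invariant (p : J) : (O * 'rV[R]_n * 'cV[R]_n)%type :=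
  (orbit_map c eta (set_val p).1.1.1, (set_val p).1.1.2, (set_val p).2).

Lemma isotropy_orbitE (p : J) :
  isotropy_orbit p = [set q | level_invariant q = level_invariant p].
Proof.
apply/seteqP; split=> q.
  move=> [g gI E]; rewrite /level_invariant /= E.
  case: (set_val p) => [[[x Y] mu] xi].
  suff gE : orbit_map c eta (g * x)%g = orbit_map c eta x by rewrite /= gE.
  apply: (@set_val_inj _ (coadjoint_orbit c eta)).
  have geta := etrans (congr1 (Ad_star c g) (esym gI)) (Ad_starVK LA Acc c1 g eta).
  apply: (etrans (set_val_orbit_map c eta (g * x)%g)).
  apply: (etrans (Ad_starM LA Acc c1 g x eta)).
  exact: (etrans (congr1 (Ad_star c x) geta) (esym (set_val_orbit_map c eta x))).
have Jp : momentum_level c eta (set_val p) by apply: set_mem; rewrite set_valE; exact: valP.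
have Jq : momentum_level c eta (set_val q) by apply: set_mem; rewrite set_valE; exact: valP.
rewrite /level_invariant /=; rewrite /isotropy_orbit /=.
case: (set_val p) Jp => [[[x Y] mu] xi] /momentum_levelP muE.
case: (set_val q) Jq => [[[x' Y'] mu'] xi'] /momentum_levelP mu'E /=.
move=> E; have YE : Y' = Y := congr1 (fun t => t.1.2) E.
have xiE : xi' = xi := congr1 snd E.
have oE : Ad_star c x' eta = Ad_star c x eta := congr1 (fun t => set_val t.1.1) E.
(* As [Ad*] is a right action, [Ad*_x' eta = Ad*_x eta] means that this element fixes [eta]; the
   components [mu] and [mu'] agree since they are determined by the others. *)
exists (x' * x^-1)%g.
  rewrite /isotropy /= invgM invgK (Ad_starM LA Acc c1) -oE.
  by rewrite (Ad_starK LA Acc c1).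
by rewrite mulgVK muE mu'E oE YE xiE.
Qed.

Lemma reduction_eq (p q : J) :
  reduction c eta p = reduction c eta q <-> level_invariant p = level_invariant q.
Proof.
split=> [E|E].
  have : isotropy_orbit p p by rewrite isotropy_orbitE.
  have -> : isotropy_orbit p = isotropy_orbit q by exact: (congr1 sval E).
  by rewrite isotropy_orbitE.
by apply: eq_exist; rewrite !isotropy_orbitE E.
Qed.

Lemma reduction_surj (q : reduced_space c eta) : exists p, reduction c eta p = q.
Proof.
case: q => Q QE; have [p pE] := QE.
by exists p; apply: eq_exist.
Qed.

Definition level_point (t : G * 'rV[R]_n * 'cV[R]_n) : J :=
  exist (fun p => p \in momentum_level c eta)
    (t.1.1, t.1.2, Ad_star c t.1.1 eta + ad_star c t.1.2 t.2, t.2)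
    (mem_set ((momentum_levelP t.1.1 t.1.2 _ t.2).2 erefl)).

Lemma set_val_level_point t : set_val (level_point t) =
  (t.1.1, t.1.2, Ad_star c t.1.1 eta + ad_star c t.1.2 t.2, t.2).
Proof. by rewrite set_valE. Qed.

Lemma level_invariant_point t :
  level_invariant (level_point t) = (orbit_map c eta t.1.1, t.1.2, t.2).
Proof. by rewrite /level_invariant set_val_level_point. Qed.

Context (k l m : nat) (AJ : set (chart 'rV[R]_k J)) (AO : set (chart 'rV[R]_m O))
  (AQ : set (chart 'rV[R]_l (reduced_space c eta))).
Hypotheses (cptG : compact [set: G]) (sJ : submanifold (phase_atlas A) AJ)
  (mQ : smooth_manifold AQ) (subm : submersion AJ AQ (reduction c eta))
  (sO : submanifold (vect_atlas 'cV[R]_n) AO).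

Let Aat := lie_atlas LA.
Let Oat : smooth_atlas AO.
Proof. by case: sO => mO _; apply: smooth_manifold_atlas => //; exact: findim_mx. Qed.
Let Jat : smooth_atlas AJ.
Proof. by case: sJ => mJ _; apply: smooth_manifold_atlas => //; exact: findim_mx. Qed.
Let Qat : smooth_atlas AQ.
Proof. by apply: smooth_manifold_atlas => //; exact: findim_mx. Qed.
Let Cat := smooth_atlas_vect (@findim_mx R n 1).
Let Rat := smooth_atlas_vect (@findim_mx R 1 n).
Let AR := smooth_atlas_prod Aat Rat.
Let ARC := smooth_atlas_prod AR Cat.
Let Pat : smooth_atlas (phase_atlas A) := smooth_atlas_prod ARC Cat.
Let OR := smooth_atlas_prod Oat Rat.
Let ORC := smooth_atlas_prod OR Cat.

Lemma smooth_level_invariant p : smooth_point AJ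
  (prod_atlas (prod_atlas AO (vect_atlas 'rV[R]_n)) (vect_atlas 'cV[R]_n))
  level_invariant p.
Proof.
have [_ [si _]] := sJ.
have s0 := (smoothP Jat Pat _).1 si p.
have s1 := smooth_point_comp Jat Pat ARC s0 (smooth_point_fst ARC Cat _).
have s2 := smooth_point_comp Jat ARC AR s1 (smooth_point_fst AR Cat _).
have sx := smooth_point_comp Jat AR Aat s2 (smooth_point_fst Aat Rat _).
have sY := smooth_point_comp Jat AR Rat s2 (smooth_point_snd Aat Rat _).
have sxi := smooth_point_comp Jat Pat Cat s0 (smooth_point_snd ARC Cat _).
have so := smooth_point_comp Jat Aat Oat sx (smooth_orbit_map LA Acc c1 sO _).
exact: (smooth_point_pair (smooth_point_pair so sY) sxi).
Qed.

Lemma smooth_level_point t : smooth_point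
  (prod_atlas (prod_atlas A (vect_atlas 'rV[R]_n)) (vect_atlas 'cV[R]_n))
  AJ level_point t.
Proof.
apply: (smooth_point_lift Pat ARC sJ).
rewrite (_ : (fun x => _) =
  fun t => (t.1.1, t.1.2, Ad_star c t.1.1 eta + ad_star c t.1.2 t.2, t.2)); last first.
  by apply/funext => u; exact: set_val_level_point.
have s1 := smooth_point_fst AR Cat t.
have sx := smooth_point_comp ARC AR Aat s1 (smooth_point_fst Aat Rat _).
have sY := smooth_point_comp ARC AR Rat s1 (smooth_point_snd Aat Rat _).
have sxi := smooth_point_snd AR Cat t.
have sA := smooth_point_comp ARC Aat Cat sx (smooth_Ad_star LA Acc c1 eta _).
have sa : smooth_point
    (prod_atlas (prod_atlas A (vect_atlas 'rV[R]_n)) (vect_atlas 'cV[R]_n))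
    (vect_atlas 'cV[R]_n) (fun t => ad_star c t.1.2 t.2) t.
  exact: (smooth_point_comp ARC (smooth_atlas_prod Rat Cat) Cat (smooth_point_pair sY sxi)
           (smooth_vect2 (smooth_ad_star LA Acc c1 _))).
have sD : smooth_point
    (prod_atlas (prod_atlas A (vect_atlas 'rV[R]_n)) (vect_atlas 'cV[R]_n))
    (vect_atlas 'cV[R]_n) (fun t => Ad_star c t.1.1 eta + ad_star c t.1.2 t.2) t.
  split=> [|e d Ee /= -> et _ k']; first exact: cvgD sA.1 sa.1.
  have a1 := sA.2 e (Chart setT id id) Ee erefl et I.
  have a2 := sa.2 e (Chart setT id id) Ee erefl et I.
  exact: (CkD (a1 k') (a2 k')).
exact: (smooth_point_pair (smooth_point_pair (smooth_point_pair sx sY) sD) sxi).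
Qed.

Lemma reduced_space_diffeomorphic : diffeomorphic AQ
  (prod_atlas (prod_atlas AO (vect_atlas 'rV[R]_n)) (vect_atlas 'cV[R]_n)).
Proof.
(* [rep] and [gx] are arbitrary choices without any continuity. [fE] and [gE] show that [f] and [g]
   do not depend on them, so near each point a smooth local section can take their place. *)
have [rep repP] := choice reduction_surj.
have [gx gxP] := choice (@orbit_map_surj R n G c eta).
pose f q := level_invariant (rep q).
pose g (t : O * 'rV[R]_n * 'cV[R]_n) :=
  reduction c eta (level_point (gx t.1.1, t.1.2, t.2)).
have fE p : f (reduction c eta p) = level_invariant p.
  by apply/reduction_eq; exact: repP.
have gE x Y xi : g (orbit_map c eta x, Y, xi) = reduction c eta (level_point (x, Y, xi)).
  apply/reduction_eq; apply: (etrans (level_invariant_point _)).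
  apply: etrans (esym (level_invariant_point _)).
  exact: (congr1 (fun o => (o, Y, xi)) (gxP _)).
exists f, g; split.
- apply/(smoothP Qat ORC) => q.
  have [p pE] := reduction_surj q.
  have [_ _ Jcov _] := Jat; have [_ _ Qcov _] := Qat.
  have [d Jd dp] := Jcov p; have [e Qe eq] := Qcov (reduction c eta p).
  have [sr surj] := subm.
  have srp := (smoothP Jat Qat _).1 sr p.
  have [s [sp ss sK]] := local_section Jat Qat Jd Qe dp eq srp (surj d e p Jd Qe dp eq).
  rewrite -pE; apply: (near_eq_smooth_point Qat (f := fun y => level_invariant (s y))).
    by apply: filterS sK => y /(congr1 f) <-; rewrite fE.
  by apply: (smooth_point_comp Qat Jat ORC ss); exact: smooth_level_invariant.
- apply/(smoothP ORC Qat) => t.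
  have [x xE] := orbit_map_surj t.1.1.
  have [s [sx ss sK]] := orbit_section LA Acc c1 cptG sO xE.
  apply: (near_eq_smooth_point ORC
    (f := fun t => reduction c eta (level_point (s t.1.1, t.1.2, t.2)))).
    have ct : {for t, continuous (fun t : O * 'rV[R]_n * 'cV[R]_n => t.1.1)}.
      exact: (continuous_comp cvg_fst cvg_fst).
    have nK : \forall u \near t, orbit_map c eta (s u.1.1) = u.1.1 by exact: (ct _ sK).
    apply: filterS nK => -[[nu Y] xi] /= nuE.
    by rewrite -[in RHS]nuE gE.
  have s1 := smooth_point_fst OR Cat t.
  have snu := smooth_point_comp ORC OR Oat s1 (smooth_point_fst Oat Rat _).
  have sY := smooth_point_comp ORC OR Rat s1 (smooth_point_snd Oat Rat _).
  have sxi := smooth_point_snd OR Cat t.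
  have sG := smooth_point_comp ORC Oat Aat snu ss.
  have sp := smooth_point_pair (smooth_point_pair sG sY) sxi.
  have sl := smooth_point_comp ORC ARC Jat sp (smooth_level_point _).
  by apply: (smooth_point_comp ORC Jat Qat sl); exact: (smoothP Jat Qat _).1 subm.1 _.
- move=> q; have [p <-] := reduction_surj q.
  rewrite fE; apply/reduction_eq; apply: (etrans (level_invariant_point _)).
  exact: (congr1 (fun o => (o, _, _)) (gxP _)).
- move=> [[nu Y] xi]; apply: (etrans (fE _)); apply: (etrans (level_invariant_point _)).
  exact: (congr1 (fun o => (o, Y, xi)) (gxP nu)).
Qed.

End Reduction.

Theorem proposition3 (R : realType) (n : nat) (G : groupTopologicalType)
    (A : set (chart 'rV[R]_n G)) (c : chart 'rV[R]_n G) (eta : 'cV[R]_n)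
    (k l m : nat)
    (AJ : set (chart 'rV[R]_k (momentum_level c eta)))
    (AQ : set (chart 'rV[R]_l (reduced_space c eta)))
    (AO : set (chart 'rV[R]_m (coadjoint_orbit c eta))) :
  lie_group A -> compact [set: G] -> connected [set: G] ->
  A c -> dom c 1%g ->
  submanifold (phase_atlas A) AJ ->
  smooth_manifold AQ -> submersion AJ AQ (reduction c eta) ->
  submanifold (vect_atlas 'cV[R]_n) AO ->
  diffeomorphic AQ
    (prod_atlas (prod_atlas AO (vect_atlas 'rV[R]_n)) (vect_atlas 'cV[R]_n)).
Proof.
move=> LA cptG _ Acc c1 sJ mQ subm sO.
exact: (reduced_space_diffeomorphic LA Acc c1 cptG sJ mQ subm sO).
Qed.
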